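(* Fix $p\in(0,1)$. Let $\xi_1,\xi_2,\ldots$ be i.i.d. with $\mathbb{P}\{\xi_1=1\}=p$ and $\mathbb{P}\{\xi_1=-1\}=1-p$, let $S_0=0$ and $S_k=\xi_1+\cdots+\xi_k$, and let $X^{n,p}:\mathbb{N}\to\{0,1\}$ be the random box-ball configuration $X^{n,p}(k)=\mathbf{1}\{\xi_k=1\}$ for $1\le k\le n$ and $X^{n,p}(k)=0$ for $k>n$. For $i\ge 1$ let $\rho_i(n)$ be the number of solitons of length at least $i$ in the box-ball system started from $X^{n,p}$. Then: (i) Let $\varsigma=\inf\{k>0: S_k=0\}\in\mathbb{N}\cup\{\infty\}$ be the first return time of $S_k$ to $0$. For any fixed $i\ge 1$, $$\frac{\rho_i(n)}{n}\to \mathbb{P}\Big\{\max_{0\le k\le \varsigma}S_k=i\Big\}>0\quad\text{a.s. as } n\to\infty.$$ (ii) As $n\to\infty$, $$\frac{\rho_1(n)-np(1-p)}{\sqrt{np(1-p)[1-3p(1-p)]}}\Rightarrow Z,$$ where $Z\sim\mathcal{N}(0,1)$ is a standard normal random variable and $\Rightarrow$ denotes convergence in distribution.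
   Context: Notation: $\mathbb{N}=\{1,2,3,\ldots\}$. Box-ball system. A (finitely supported) box-ball configuration is a map $X:\mathbb{N}\to\{0,1\}$ with finitely many $1$'s ($X(k)=1$ means box $k$ contains a ball). One update (sweep) $X\mapsto X'$: a carrier with load $c_0=0$ visits boxes $k=1,2,\ldots$ in order; if $X(k)=1$ then $c_k=c_{k-1}+1$ and $X'(k)=0$; if $X(k)=0$ and $c_{k-1}\ge1$ then $c_k=c_{k-1}-1$ and $X'(k)=1$; if $X(k)=0$ and $c_{k-1}=0$ then $c_k=0$ and $X'(k)=0$. The box-ball system started from $X_0$ is $(X_s)_{s\ge0}$ with $X_{s+1}=(X_s)'$. Solitons. A (non-interacting) soliton of length $k$ is a string of $k$ consecutive $1$'s followed by $k$ consecutive $0$'s. Started from any finitely supported $X_0$, after finitely many updates the configuration becomes stable: it consists of non-interacting solitons whose lengths are nondecreasing from left to right. The resulting multiset of soliton lengths (which no longer changes) is by definition the multiset of soliton lengths of the system started from $X_0$. *)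

(* Defs.v *)
From HB Require Import structures.
From mathcomp Require Import all_boot all_order all_algebra.
From mathcomp Require Import all_classical all_reals all_analysis.

Set Implicit Arguments.
Unset Strict Implicit.
Unset Printing Implicit Defensive.

Import Order.TTheory GRing.Theory Num.Theory.
Import numFieldNormedType.Exports.

Local Open Scope classical_set_scope.
Local Open Scope ring_scope.

(* Boxes 1, 2, 3, ... are indexed from 0: [X k] tells whether box number k + 1
   contains a ball. *)
Definition bbs_config := nat -> bool.

(* [load X k] is the load c_k of the carrier after it has visited the first k
   boxes; the carrier stays empty (0.-1 = 0) when it meets an empty box. *)
Fixpoint load (X : bbs_config) (k : nat) : nat :=
  if k is k'.+1 then
    if X k' then (load X k').+1 else (load X k').-1
  else 0%N.

Definition sweep (X : bbs_config) : bbs_config :=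
  fun k => ~~ X k && (0 < load X k)%N.

(* The word  0^g 1^l 0^l : a soliton of length l, preceded by a gap g. *)
Definition soliton_word (gl : nat * nat) : seq bool :=
  nseq gl.1 false ++ nseq gl.2 true ++ nseq gl.2 false.

(* [X] consists of non-interacting solitons, whose lengths, read from left to
   right, are given by the nondecreasing sequence [ls]. *)
Definition stable_with (X : bbs_config) (ls : seq nat) : Prop :=
  [/\ all (leq 1) ls, sorted leq ls &
      exists2 gs : seq nat, size gs = size ls &
        forall k, X k = nth false (flatten (map soliton_word (zip gs ls))) k].

(* The multiset of soliton lengths, represented by its nondecreasing
   enumeration; the default value [::] is irrelevant, since every finitely
   supported configuration eventually becomes stable. *)
Definition soliton_lengths (X : bbs_config) : seq nat :=
  xget [::] [set ls | exists s0, forall s, (s0 <= s)%N ->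
                        stable_with (iter s sweep X) ls].

Definition nb_solitons_ge (i : nat) (X : bbs_config) : nat :=
  count (leq i) (soliton_lengths X).

(* For a sequence of steps [x], the term [x k] is the step number k + 1. *)
Section paths.
Context {R : realType}.
Implicit Types (x : nat -> R) (n k : nat).

Definition walk x k : R := \sum_(j < k) x j.

Definition config_of_steps x n : bbs_config :=
  fun k => (k < n)%N && (x k == 1).

Definition rho i n x : nat := nb_solitons_ge i (config_of_steps x n).

Definition return_time x : \bar R :=
  ereal_inf [set k%:R%:E | k in [set k | (0 < k)%N /\ walk x k = 0]].

(* The maximum of the walk up to its return time, as an extended real because
   the return time may be +oo. *)
Definition max_until_return x : \bar R :=
  ereal_sup [set (walk x k)%:E | k in [set k | (k%:R%:E <= return_time x)%E]].

End paths.

Section probability.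
Context d (T : measurableType d) (R : realType) (P : probability T R).

Definition mutually_independent (X : nat -> {RV P >-> R}) : Prop :=
  forall (J : seq nat) (A : nat -> set R), uniq J ->
    (forall j, measurable (A j)) ->
    P (\big[setI/setT]_(j <- J) (X j @^-1` A j)) =
    (\prod_(j <- J) P (X j @^-1` A j))%E.

(* The laws are only compared on measurable sets: the values of a measure on
   other sets carry no meaning. *)
Definition iid (X : nat -> {RV P >-> R}) : Prop :=
  mutually_independent X /\
  forall k (A : set R), measurable A ->
    distribution P (X k) A = distribution P (X 0%N) A.

(* Convergence of the distribution functions of the random variables [Y n] to
   that of the law [mu], at every continuity point of the latter. *)
Definition cvg_in_distribution (Y : nat -> T -> R)
    (mu : probability (measurableTypeR R) R) : Prop :=
  (forall n, measurable_fun setT (Y n)) /\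
  forall x : R, {for x, continuous (fun y : R => mu `]-oo, y]%classic)} ->
    P [set w | Y n w <= x] @[n --> \oo] --> mu `]-oo, x]%classic.

End probability.

(* Main.v *)
Require Import Defs.
From HB Require Import structures.
From mathcomp Require Import all_boot all_order all_algebra.
From mathcomp Require Import all_classical all_reals all_analysis.
From mathcomp Require Import measurable_realfun ring lra.
From mathcomp Require Import zify.

Set Implicit Arguments.
Unset Strict Implicit.
Unset Printing Implicit Defensive.

Import Order.TTheory GRing.Theory Num.Theory.
Import numFieldNormedType.Exports.

Local Open Scope classical_set_scope.
Local Open Scope ring_scope.

(** The number of solitons of length at least [i] is conserved, because it is
the number of runs of balls that remain once the pairs "10" have been removed
[i - 1] times, i.e. the number of runs in the overflow of a carrier of capacity
[i - 1], and because this removal commutes with the sweep up to empty boxes at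
the ends of the word.  The overflow is read off by a finite automaton driven by
the i.i.d. steps.  For (i), the Poisson equation of this automaton has an
explicit solution in terms of gambler's ruin probabilities; it turns the number
of runs into a martingale with bounded increments, to which an exponential
inequality and the Borel-Cantelli lemma apply, and the drift is the probability
of an excursion of height exactly [i].  For (ii), the number of runs minus its
mean is, up to a bounded term, a martingale with increments
[(a_k - p) (b_(k-1) - p)], where [a_k] and [b_k] indicate that box [k] contains
a ball and is empty.  Lindeberg's method applies to it with the test functions
[x |-> Phi ((a - x) / sqrt t)], which solve the heat equation; convergence of
the expectation of the Gaussian-smoothed indicators gives convergence of the
distribution functions. *)

(** * Solitons and overflow of finite carriers *)

Section overflow.
Local Open Scope nat_scope.

(** [soliton_lengths] takes its value from [xget], so nothing is known about it until stabilisation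
    is proved for every finitely supported configuration. That proof is an induction on the number
    of balls, then on the length of the first run: this run either shrinks at some time, or belongs
    to a soliton that travels undisturbed and can be split off. Conditional expectations are avoided
    throughout: an event depending on n steps is a predicate on words, its probability is the finite
    recursion [mean], and a martingale is a function of words with an averaging identity over the
    two one-letter extensions. The obstacle in (ii) is that the conditional variance V (b - p)^2 of
    an increment, with V = p (1 - p), depends on the last letter. A second-order correction of the
    test function replaces (b - p)^2 by its mean p^3 + (1 - p)^3 = 1 - 3V, whence the normalisation
    V (1 - 3V). *)

Definition carrier_step (m : nat) (s : nat * seq bool) (x : bool) :
    nat * seq bool :=
  if x then if s.1 < m then (s.1.+1, s.2) else (s.1, rcons s.2 true)
  else if 0 < s.1 then (s.1.-1, s.2) else (s.1, rcons s.2 false).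

Definition carrier m (w : seq bool) := foldl (carrier_step m) (0, [::]) w.
Definition carrier_load m w := (carrier m w).1.
(* The letters that the carrier of capacity [m] could not process: the balls
   met when full and the empty boxes met when empty. *)
Definition overflow m w := (carrier m w).2.

Lemma carrier_load_rcons m w x : carrier_load m (rcons w x) =
  if x then if carrier_load m w < m then (carrier_load m w).+1
            else carrier_load m w
  else (carrier_load m w).-1.
Proof.
rewrite /carrier_load /carrier foldl_rcons /carrier_step.
by case: (foldl _ _ _) => [[|v] out] /=; case: x => //=; case: ifP.
Qed.

Lemma overflow_rcons m w x : overflow m (rcons w x) =
  if x then if carrier_load m w < m then overflow m w
            else rcons (overflow m w) true
  else if 0 < carrier_load m w then overflow m w
       else rcons (overflow m w) false.
Proof.
rewrite /carrier_load /overflow /carrier foldl_rcons /carrier_step.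
by case: (foldl _ _ _) => [[|v] out] /=; case: x => //=; case: ifP.
Qed.

Lemma carrier_load_le m w : carrier_load m w <= m.
Proof.
elim/last_ind: w => // w x IH; rewrite carrier_load_rcons.
by case: x; [case: ifP|lia].
Qed.

Lemma carrier_load0 w : carrier_load 0 w = 0.
Proof. by apply/eqP; rewrite -leqn0 carrier_load_le. Qed.

Lemma overflow0 w : overflow 0 w = w.
Proof.
elim/last_ind: w => // w x IH; rewrite overflow_rcons carrier_load0 IH.
by case: x.
Qed.

(** Carriers in series: the unit carrier passes on a ball only when full and an empty box only when
    empty, so together with a carrier of capacity [m] fed by its overflow it acts as one carrier
    whose load is the sum. *)
Lemma carrierS m w :
  overflow m.+1 w = overflow m (overflow 1 w) /\
  carrier_load m.+1 w = carrier_load 1 w + carrier_load m (overflow 1 w).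
Proof.
elim/last_ind: w => // w x [IHo IHl].
rewrite !overflow_rcons !carrier_load_rcons IHo IHl.
have := carrier_load_le 1 w; have := carrier_load_le m (overflow 1 w).
case: x; move: (carrier_load 1 w) => v1.
- case: (ltnP v1 1) => h1; rewrite ?overflow_rcons ?carrier_load_rcons /=;
    move: (carrier_load m _) => v; repeat case: ifP; intros; split => //; lia.
- case: (ltnP 0 v1) => h1; rewrite ?overflow_rcons ?carrier_load_rcons /=;
    move: (carrier_load m _) => v; repeat case: ifP; intros; split => //; lia.
Qed.

Lemma carrier_load_cons0 m w : carrier_load m (false :: w) = carrier_load m w.
Proof.
elim/last_ind: w => // w x IH.
by rewrite -rcons_cons !carrier_load_rcons IH.
Qed.

Lemma overflow_cons0 m w : overflow m (false :: w) = false :: overflow m w.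
Proof.
elim/last_ind: w => // w x IH.
rewrite -rcons_cons !overflow_rcons IH carrier_load_cons0.
by case: x; case: ifP.
Qed.

Lemma carrier_cat m u w : carrier_load m u = 0 ->
  carrier_load m (u ++ w) = carrier_load m w /\
  overflow m (u ++ w) = overflow m u ++ overflow m w.
Proof.
move=> u0; elim/last_ind: w => [|w x [IHl IHo]]; first by rewrite !cats0.
rewrite -rcons_cat !overflow_rcons !carrier_load_rcons IHl IHo; split => //.
by case: x; case: ifP; rewrite ?rcons_cat.
Qed.

(** * Runs of balls in a word *)

Definition nb_runs (w : seq bool) :=
  (foldl (fun s x => (x, s.2 + (~~ s.1 && x))) (false, 0) w).2.

Lemma nb_runs_rcons w x :
  nb_runs (rcons w x) = nb_runs w + (~~ last false w && x).
Proof.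
rewrite /nb_runs foldl_rcons /=; congr (_ + (~~ _ && _)).
by elim/last_ind: w => // w y _; rewrite foldl_rcons last_rcons.
Qed.

Lemma nb_runs_rcons0 w : nb_runs (rcons w false) = nb_runs w.
Proof. by rewrite nb_runs_rcons andbF addn0. Qed.

Lemma nb_runs_cat u w : last false u = false ->
  nb_runs (u ++ w) = nb_runs u + nb_runs w.
Proof.
move=> u0; elim/last_ind: w => [|w x IH]; first by rewrite cats0 addn0.
rewrite -rcons_cat !nb_runs_rcons IH addnA last_cat.
by case: (lastP w) => [|w' y] /=; rewrite ?u0 ?last_rcons.
Qed.

Lemma nb_runs_cons0 w : nb_runs (false :: w) = nb_runs w.
Proof. by rewrite (@nb_runs_cat [:: false]). Qed.

Definition nb_overflow_runs m w := nb_runs (overflow m w).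

Lemma nb_overflow_runs_rcons0 m w :
  nb_overflow_runs m (rcons w false) = nb_overflow_runs m w.
Proof.
rewrite /nb_overflow_runs overflow_rcons; case: ifP => // _.
exact: nb_runs_rcons0.
Qed.

Lemma nb_overflow_runs_cons0 m w :
  nb_overflow_runs m (false :: w) = nb_overflow_runs m w.
Proof. by rewrite /nb_overflow_runs overflow_cons0 nb_runs_cons0. Qed.

(** * The sweep on finite words *)

Definition word_load (w : seq bool) : nat :=
  foldl (fun c (x : bool) => if x then c.+1 else c.-1) 0 w.

(** Cut off at the end of the word: balls still carried there are lost, so words are usually taken
    long enough for the carrier to end empty. *)
Definition word_sweep (w : seq bool) : seq bool :=
  (foldl (fun s (x : bool) => (if x then s.1.+1 else s.1.-1,
                      rcons s.2 (~~ x && (0 < s.1)))) (0, [::]) w).2.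

Lemma word_load_rcons w x : word_load (rcons w x) =
  if x then (word_load w).+1 else (word_load w).-1.
Proof. by rewrite /word_load foldl_rcons. Qed.

Lemma word_sweep_rcons w x : word_sweep (rcons w x) =
  rcons (word_sweep w) (~~ x && (0 < word_load w)).
Proof.
rewrite /word_sweep foldl_rcons /=; congr (rcons _ (_ && (_ < _))).
elim/last_ind: w {x} => // w x IH.
by rewrite foldl_rcons word_load_rcons /= IH.
Qed.

Lemma size_word_sweep w : size (word_sweep w) = size w.
Proof.
elim/last_ind: w => // w x IH.
by rewrite word_sweep_rcons !size_rcons IH.
Qed.

Lemma word_load_gt0 w : last false w -> 0 < word_load w.
Proof.
case: (lastP w) => // w' x; rewrite last_rcons => x1.
by rewrite word_load_rcons x1.
Qed.

Lemma last_word_sweep w : 0 < word_load w ->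
  last false (word_sweep w) = ~~ last false w.
Proof.
case: (lastP w) => // w' x.
rewrite word_load_rcons word_sweep_rcons !last_rcons.
by case: x => //=; case: (word_load w').
Qed.

(** A loaded carrier exchanges balls and empty boxes, so a run of dropped balls starts exactly where
    a run of [w] has ended; only a run reaching the end of [w] has no counterpart yet. *)
Lemma nb_runs_sweep w : nb_runs w = nb_runs (word_sweep w) + last false w.
Proof.
elim/last_ind: w => // w x IH.
rewrite word_sweep_rcons !nb_runs_rcons last_rcons IH.
case: (posnP (word_load w)) => [w0|w_gt0].
  have -> : last false w = false.
    by apply/negbTE/negP => /word_load_gt0; rewrite w0.
  by rewrite andbF !andbF; lia.
by rewrite last_word_sweep// andbT; case: x; case: (last false w); rewrite /=; lia.
Qed.

Lemma word_load_overflow w :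
  word_load w = word_load (overflow 1 w) + carrier_load 1 w.
Proof.
elim/last_ind: w => // w x IH.
rewrite overflow_rcons carrier_load_rcons word_load_rcons IH.
have := carrier_load_le 1 w.
by case: x; repeat case: ifP; intros; rewrite ?word_load_rcons; lia.
Qed.

(* Eliminating the patterns "10" commutes with the sweep, up to an empty box
   which moves from the left to the right end of the word whenever the carrier
   gets empty. *)
Lemma overflow_sweep w :
  let Z := overflow 1 (word_sweep w) in let Y := word_sweep (overflow 1 w) in
  let v' := carrier_load 1 (word_sweep w) in let v := carrier_load 1 w in
  (v' = 1 - v /\ Z = false :: Y) \/
  [/\ word_load w = 0, v = 0, v' = 0 & rcons Z false = false :: Y].
Proof.
elim/last_ind: w => [|w x] /=; first by right.
have hl := word_load_overflow w.
rewrite !word_sweep_rcons word_load_rcons !overflow_rcons !carrier_load_rcons.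
have := carrier_load_le 1 w.
case=> hv [[hv' ZY]|[hl0 hv0 hv' ZY]].
  rewrite hv' ZY.
  case: x => /=.
    left; case: (posnP (carrier_load 1 w)) => h.
      by rewrite h.
    have -> : carrier_load 1 w = 1 by lia.
    by rewrite /= word_sweep_rcons /= -rcons_cons.
  case: (posnP (carrier_load 1 w)) => h; last first.
    have h1 : carrier_load 1 w = 1 by lia.
    have h2 : (0 < word_load w) by lia.
    by rewrite h1 h2 /=; left.
  rewrite h /= word_sweep_rcons /= hl h addn0.
  (* The unit carrier is empty, so both loads agree. If they vanish, the new letter of the sweep
     cancels against the ball held by its unit carrier, and the surplus empty box on the left of [Z]
     is matched by one on the right of [Y]. *)
  case: (posnP (word_load (overflow 1 w))) => h' /=.
    by right; split => //; rewrite h'.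
  by left.
rewrite hv' hl0 hv0 ZY.
have h0 : word_load (overflow 1 w) = 0 by lia.
case: x => /=; first by left.
by right; split => //; rewrite word_sweep_rcons /= h0.
Qed.

Lemma nb_overflow_runs_sweep m w : word_load w = 0 ->
  nb_overflow_runs m (word_sweep w) = nb_overflow_runs m w.
Proof.
elim: m w => [|m IH] w w0.
  rewrite /nb_overflow_runs !overflow0 (nb_runs_sweep w).
  by case: (boolP (last false w)) => [/word_load_gt0|]; lia.
rewrite {1}/nb_overflow_runs (carrierS m (word_sweep w)).1.
rewrite -/(nb_overflow_runs m _).
have -> : nb_overflow_runs m.+1 w = nb_overflow_runs m (overflow 1 w).
  by rewrite /nb_overflow_runs (carrierS m w).1.
rewrite -[RHS]IH; last by have := word_load_overflow w; lia.
have [[_ ->]|[_ _ _ ZY]] := overflow_sweep w.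
  exact: nb_overflow_runs_cons0.
rewrite -(nb_overflow_runs_rcons0 m (overflow 1 _)).
by rewrite ZY nb_overflow_runs_cons0.
Qed.

Lemma load_mkseq X k : load X k = word_load (mkseq X k).
Proof.
elim: k => // k IH /=; rewrite IH.
by rewrite mkseqS word_load_rcons.
Qed.

Lemma mkseq_sweep X k : mkseq (sweep X) k = word_sweep (mkseq X k).
Proof.
elim: k => // k IH.
by rewrite !mkseqS word_sweep_rcons IH /sweep load_mkseq.
Qed.

Definition supported_below (X : bbs_config) K := forall k, K <= k -> X k = false.

Lemma supported_below_sweep X K : supported_below X K ->
  supported_below (sweep X) (K + load X K).
Proof.
move=> XK k Kk; rewrite /sweep.
have H t : load X (K + t) = load X K - t.
  elim: t => [|t IH]; first by rewrite addn0 subn0.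
  by rewrite addnS /= XK ?leq_addr// IH subnS.
by have := H (k - K); rewrite subnKC; [move=> ->|]; lia.
Qed.

Lemma nb_overflow_runs_supported m X K k : supported_below X K -> K <= k ->
  nb_overflow_runs m (mkseq X k) = nb_overflow_runs m (mkseq X K).
Proof.
move=> XK; elim: k => [|k IH]; first by rewrite leqn0 => /eqP ->.
rewrite leq_eqVlt ltnS => /orP[/eqP ->//|Kk].
by rewrite mkseqS XK// nb_overflow_runs_rcons0 IH.
Qed.

Lemma nb_overflow_runs_iter_sweep m X K s : supported_below X K ->
  exists2 K', supported_below (iter s sweep X) K' &
   nb_overflow_runs m (mkseq (iter s sweep X) K') =
   nb_overflow_runs m (mkseq X K).
Proof.
move=> XK; elim: s => [|s [K' XK' IH]]; first by exists K.
have XK'' := supported_below_sweep XK'.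
set X' := iter s sweep X in XK' IH XK''.
set K2 := K' + load X' K' in XK''.
have X'K2 : supported_below X' K2 by move=> k h; apply: XK'; rewrite /K2 in h; lia.
have XK3 := supported_below_sweep X'K2.
exists K2; rewrite iterS -/X' //.
(* A carrier still loaded at the empty box [K2] would leave a ball there, outside the support of the
   sweep. *)
have l0 : load X' K2 = 0.
  apply/eqP; rewrite -leqn0 leqNgt; apply/negP => h.
  by have := XK'' K2 (leqnn _); rewrite /sweep X'K2 ?h.
rewrite mkseq_sweep nb_overflow_runs_sweep -?load_mkseq//.
by rewrite (nb_overflow_runs_supported _ XK') ?IH ?leq_addr.
Qed.

(** * Words made of solitons *)

Lemma cat_nseqSr T (u : seq T) k x :
  u ++ nseq k.+1 x = rcons (u ++ nseq k x) x.
Proof. by rewrite -addn1 nseqD catA cats1. Qed.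

Lemma last_nseq T (x y : T) k : last x (nseq k y) = if k is 0 then x else y.
Proof. by case: k => //; elim. Qed.

Lemma word_load_cat_true u k : word_load (u ++ nseq k true) = word_load u + k.
Proof.
elim: k => [|k IH]; first by rewrite cats0 addn0.
by rewrite cat_nseqSr word_load_rcons IH addnS.
Qed.

Lemma word_load_cat_false u k : word_load (u ++ nseq k false) = word_load u - k.
Proof.
elim: k => [|k IH]; first by rewrite cats0 subn0.
by rewrite cat_nseqSr word_load_rcons IH subnS.
Qed.

Lemma word_sweep_cat_true u k :
  word_sweep (u ++ nseq k true) = word_sweep u ++ nseq k false.
Proof.
elim: k => [|k IH]; first by rewrite !cats0.
by rewrite !cat_nseqSr word_sweep_rcons IH.
Qed.

Lemma word_sweep_cat_false u k :
  word_sweep (u ++ nseq k false) =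
  word_sweep u ++ nseq (minn k (word_load u)) true
               ++ nseq (k - word_load u) false.
Proof.
elim: k => [|k IH]; first by rewrite min0n sub0n !cats0.
rewrite cat_nseqSr word_sweep_rcons IH word_load_cat_false /=.
have [h|h] : k < word_load u \/ word_load u <= k by lia.
  have -> : minn k.+1 (word_load u) = (minn k (word_load u)).+1 by lia.
  have -> : k.+1 - word_load u = 0 by lia.
  have -> : k - word_load u = 0 by lia.
  have -> : (0 < word_load u - k) by lia.
  by rewrite [nseq 0 _]/= !cats0 cat_nseqSr.
have -> : minn k.+1 (word_load u) = minn k (word_load u) by lia.
have -> : k.+1 - word_load u = (k - word_load u).+1 by lia.
have -> : (0 < word_load u - k) = false by lia.
by rewrite !catA cat_nseqSr.
Qed.

Lemma word_load_nseq0 g : word_load (nseq g false) = 0.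
Proof. by rewrite -[nseq g _]cat0s word_load_cat_false. Qed.

Lemma word_sweep_nseq0 g : word_sweep (nseq g false) = nseq g false.
Proof.
rewrite -[X in word_sweep X]cat0s word_sweep_cat_false.
by rewrite [word_load [::]]/= subn0 minn0.
Qed.

Lemma word_load_soliton gl : word_load (soliton_word gl) = 0.
Proof.
rewrite /soliton_word catA word_load_cat_false word_load_cat_true.
by rewrite word_load_nseq0; lia.
Qed.

Lemma word_sweep_soliton g l :
  word_sweep (soliton_word (g, l)) = nseq (g + l) false ++ nseq l true.
Proof.
rewrite /soliton_word catA word_sweep_cat_false word_load_cat_true.
rewrite word_load_nseq0 word_sweep_cat_true word_sweep_nseq0 /= add0n minnn.
by rewrite subnn cats0 nseqD.
Qed.

Lemma word_cat u v : word_load u = 0 ->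
  word_load (u ++ v) = word_load v /\
  word_sweep (u ++ v) = word_sweep u ++ word_sweep v.
Proof.
move=> u0; elim/last_ind: v => [|v x [IHl IHs]]; first by rewrite !cats0.
by rewrite -rcons_cat !word_load_rcons !word_sweep_rcons IHl IHs rcons_cat.
Qed.

(** The carrier takes the first [minn m l] balls and unloads them into the first empty boxes behind
    the run. Truncated subtraction covers the solitons that disappear. *)
Lemma carrier_soliton m g l :
  carrier_load m (soliton_word (g, l)) = 0 /\
  overflow m (soliton_word (g, l)) = soliton_word (g, l - m).
Proof.
have H0 u k : carrier_load m (u ++ nseq k false) = carrier_load m u - k /\
    overflow m (u ++ nseq k false) =
      overflow m u ++ nseq (k - carrier_load m u) false.
  elim: k => [|k [IHl IHo]]; first by rewrite !cats0 subn0.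
  rewrite cat_nseqSr carrier_load_rcons overflow_rcons IHl IHo.
  split; first by lia.
  case: ifP => h.
    by have -> : k.+1 - carrier_load m u = k - carrier_load m u by lia.
  have -> : k.+1 - carrier_load m u = (k - carrier_load m u).+1 by lia.
  by rewrite cat_nseqSr.
have H1 u k : carrier_load m u = 0 ->
    carrier_load m (u ++ nseq k true) = minn m k /\
    overflow m (u ++ nseq k true) = overflow m u ++ nseq (k - m) true.
  move=> u0; elim: k => [|k [IHl IHo]]; first by rewrite !cats0 u0 minn0.
  rewrite cat_nseqSr carrier_load_rcons overflow_rcons IHl IHo.
  case: ifP => h; split; try lia.
    by have -> : k.+1 - m = k - m by lia.
  have -> : k.+1 - m = (k - m).+1 by lia.
  by rewrite cat_nseqSr.
have [g0 og] := H0 [::] g.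
have [l1 ol] := H1 (nseq g false) l g0.
have [l2 ol2] := H0 (nseq g false ++ nseq l true) l.
rewrite /soliton_word /= catA l2 ol2 l1 ol og /=; split; first lia.
by rewrite subn0 -catA; congr (_ ++ (_ ++ nseq _ _)); lia.
Qed.

Lemma nb_runs_soliton g l : nb_runs (soliton_word (g, l)) = (0 < l).
Proof.
have H u k : nb_runs (u ++ nseq k false) = nb_runs u.
  elim: k => [|k IH]; first by rewrite cats0.
  by rewrite cat_nseqSr nb_runs_rcons0.
have Hg : nb_runs (nseq g false) = 0 by have := H [::] g.
have lastg : last false (nseq g false) = false by elim: g {Hg}.
rewrite /soliton_word /= catA H nb_runs_cat// Hg.
by case: l => // l; elim: l.
Qed.

Lemma nb_overflow_runs_solitons m L :
  nb_overflow_runs m (flatten (map soliton_word L)) = count (leq m.+1) (unzip2 L).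
Proof.
elim: L => // -[g l] L IH /=.
have [l0 ol] := carrier_soliton m g l.
rewrite /nb_overflow_runs (carrier_cat _ l0).2 ol nb_runs_cat.
  by rewrite nb_runs_soliton subn_gt0 -/(nb_overflow_runs _ _) IH.
by rewrite /soliton_word !last_cat !last_nseq /=; case: (l - m); case: (g).
Qed.

Lemma nb_overflow_runs_stable m X ls : stable_with X ls ->
  exists2 K, supported_below X K &
             nb_overflow_runs m (mkseq X K) = count (leq m.+1) ls.
Proof.
case=> _ _ [gs sgs XE].
set w := flatten (map soliton_word (zip gs ls)) in XE.
exists (size w); first by move=> k wk; rewrite XE nth_default.
have -> : mkseq X (size w) = w.
  by rewrite -[RHS](mkseq_nth false); apply: eq_mkseq => k; rewrite XE.
by rewrite nb_overflow_runs_solitons unzip2_zip// sgs.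
Qed.

End overflow.

(** * Stabilisation *)

Section stabilisation.
Local Open Scope nat_scope.

Definition config_cat (u : seq bool) (U : bbs_config) : bbs_config :=
  fun k => if k < size u then nth false u k else U (k - size u).

Lemma mkseq_config_cat u U k :
  mkseq (config_cat u U) (size u + k) = u ++ mkseq U k.
Proof.
elim: k => [|k IH].
  rewrite addn0 cats0 -[RHS](mkseq_nth false); apply/eq_in_map => j.
  by rewrite mem_iota /config_cat => /andP[_ ->].
by rewrite addnS !mkseqS IH -rcons_cat /config_cat ltnNge leq_addr/= addKn.
Qed.

Lemma eq_config n (X Y : bbs_config) :
  (forall k, mkseq X (n + k) = mkseq Y (n + k)) -> X = Y.
Proof.
move=> XY; apply/funext => j; have := XY j.+1.
move=> /(congr1 (fun w => nth false w j)).
by rewrite !nth_mkseq; lia.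
Qed.

Lemma config_cat_cat u v U :
  config_cat (u ++ v) U = config_cat u (config_cat v U).
Proof.
apply: (@eq_config (size (u ++ v))) => k.
by rewrite mkseq_config_cat size_cat -addnA !mkseq_config_cat catA.
Qed.

Lemma config_cat_nth u w : config_cat u (nth false w) = nth false (u ++ w).
Proof. by apply/funext => k; rewrite /config_cat nth_cat. Qed.

Lemma config_cat_inj u U V : config_cat u U = config_cat u V -> U = V.
Proof.
move=> UV; apply/funext => k; have /(congr1 (fun X => X (size u + k))) := UV.
by rewrite /config_cat ltnNge leq_addr addKn.
Qed.

Lemma config_cat_mkseq X n : X = config_cat (mkseq X n) (fun k => X (n + k)).
Proof.
apply/funext => k; rewrite /config_cat size_mkseq.
by case: ltnP => kn; [rewrite nth_mkseq|rewrite subnKC].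
Qed.

Lemma sweep_config_cat u U : word_load u = 0 ->
  sweep (config_cat u U) = config_cat (word_sweep u) (sweep U).
Proof.
move=> u0; apply: (@eq_config (size u)) => k.
rewrite mkseq_sweep mkseq_config_cat (word_cat _ u0).2 -[in RHS]size_word_sweep.
by rewrite mkseq_config_cat mkseq_sweep.
Qed.

Lemma sweep_gap n U :
  sweep (config_cat (nseq n false) U) = config_cat (nseq n false) (sweep U).
Proof. by rewrite sweep_config_cat ?word_load_nseq0// word_sweep_nseq0. Qed.

Definition soliton_config L : bbs_config :=
  nth false (flatten (map soliton_word L)).

Lemma soliton_config_cons gl L :
  soliton_config (gl :: L) = config_cat (soliton_word gl) (soliton_config L).
Proof. by rewrite config_cat_nth. Qed.

(** A soliton of length [l] advances by [l] boxes, while its left neighbour, of length [c], advances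
    by [c]. The subtraction is exact when lengths are nondecreasing. *)
Fixpoint next_gaps c L : seq (nat * nat) :=
  if L is (g, l) :: L' then (g + l - c, l) :: next_gaps l L' else [::].

Lemma next_gaps_lengths c L : unzip2 (next_gaps c L) = unzip2 L.
Proof. by elim: L c => // -[g l] L IH c /=; rewrite IH. Qed.

(** [c] is the length of the soliton on the left: once it has moved, its [c] trailing empty boxes
    are the first [c] boxes of the swept remainder. *)
Lemma sweep_soliton_config c L : path leq c (unzip2 L) ->
  sweep (soliton_config L) =
  config_cat (nseq c false) (soliton_config (next_gaps c L)).
Proof.
elim: L c => [|[g l] L IH] c /=.
  move=> _; apply: (@eq_config c) => k.
  have := mkseq_config_cat (nseq c false) (soliton_config [::]) k.
  rewrite size_nseq mkseq_sweep => ->.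
  have H n : mkseq (soliton_config [::]) n = nseq n false.
    by apply: (@eq_from_nth _ false);
      rewrite size_mkseq ?size_nseq// => i ik;
        rewrite nth_mkseq// nth_nseq ik /soliton_config /= nth_nil.
  by rewrite !H word_sweep_nseq0 nseqD.
move=> /andP[cl Ll]; rewrite !soliton_config_cons sweep_config_cat.
  rewrite (IH l)// -!config_cat_cat word_sweep_soliton; congr config_cat.
  rewrite /soliton_word /= -!catA [RHS]catA -nseqD.
  by congr (nseq _ _ ++ _); lia.
exact: word_load_soliton.
Qed.

Lemma soliton_config_stable L : all (leq 1) (unzip2 L) ->
  sorted leq (unzip2 L) -> stable_with (soliton_config L) (unzip2 L).
Proof.
move=> L1 sL; split=> //; exists (unzip1 L) => [|k].
  by rewrite !size_map.
by rewrite zip_unzip.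
Qed.

Lemma iter_sweep_soliton_config s L : sorted leq (unzip2 L) ->
  iter s sweep (soliton_config L) = soliton_config (iter s (next_gaps 0) L) /\
  unzip2 (iter s (next_gaps 0) L) = unzip2 L.
Proof.
move=> sL; elim: s => //= s [-> IH]; rewrite next_gaps_lengths IH; split => //.
rewrite (@sweep_soliton_config 0); last by rewrite IH; case: (unzip2 L) sL.
by apply/funext => k; rewrite /config_cat /= subn0.
Qed.

(** * The first run and the emergence of solitons *)

Definition eventually_solitons X := exists s L,
  [/\ all (leq 1) (unzip2 L), sorted leq (unzip2 L) &
      iter s sweep X = soliton_config L].

Definition first_run Q X := exists g V,
  [/\ 0 < Q, V 0 = false & X = config_cat (nseq g false ++ nseq Q true) V].

Lemma sweep_at0 X : sweep X 0 = false.
Proof. by rewrite /sweep /= andbF. Qed.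

Lemma gap_or_first_run Q V : V 0 = false ->
  (exists U, V = config_cat (nseq Q false) U) \/
  (exists e (V' : bbs_config), [/\ 0 < e, e < Q, V' 0 & V =
    config_cat (nseq e false) V']).
Proof.
move=> V0; have [allF|] := boolP (all (fun k => ~~ V k) (iota 0 Q)).
  left; exists (fun k => V (Q + k)); rewrite {1}(config_cat_mkseq V Q).
  congr config_cat; apply: (@eq_from_nth _ false); rewrite size_mkseq ?size_nseq//.
  move=> i iQ; rewrite nth_mkseq// nth_nseq iQ.
  by apply/negbTE/(allP allF); rewrite mem_iota.
rewrite -has_predC => /hasP exV; right.
have [e0 e0Q Ve0] : exists2 e, e < Q & V e.
  by have [e] := exV; rewrite mem_iota => /= eQ /negPn Ve; exists e.
have {}exV : exists e, V e by exists e0.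
have [] := ex_minnP exV => e Ve emin; exists e, (fun k => V (e + k)); split.
- by case: e Ve {emin} => //; rewrite V0.
- exact: leq_ltn_trans (emin _ Ve0) e0Q.
- by rewrite addn0.
- rewrite {1}(config_cat_mkseq V e); congr config_cat.
  apply: (@eq_from_nth _ false); rewrite size_mkseq ?size_nseq// => i ie.
  rewrite nth_mkseq// nth_nseq ie; apply/negbTE/negP => /emin; lia.
Qed.

(** If only [e < Q] empty boxes follow the run, the sweep fills these and empties the next box,
    which held a ball, so the new first run has length [e]. This gives the decreasing measure for
    stabilisation. *)
Lemma first_run_sweep g Q V : 0 < Q -> V 0 = false ->
  (exists U, V = config_cat (nseq Q false) U) \/
  (exists2 e, e < Q &
     first_run e (sweep (config_cat (nseq g false ++ nseq Q true) V))).
Proof.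
move=> Q0 V0; have [|[e [V' [e0 eQ V'0 VE]]]] := gap_or_first_run Q V0;
  first by left.
right; exists e => //; rewrite VE -config_cat_cat.
set u := _ ++ nseq e false; set X := config_cat u V'.
exists (g + Q), (fun k => sweep X (size u + k)); split => //.
  rewrite addn0 /sweep /X /config_cat ltnn subnn V'0.
  by [].
rewrite {1}(config_cat_mkseq (sweep X) (size u)); congr config_cat.
have := mkseq_config_cat u V' 0; rewrite addn0 cats0 mkseq_sweep => ->.
rewrite /u word_sweep_cat_false word_sweep_cat_true word_load_cat_true.
rewrite word_load_nseq0 word_sweep_nseq0 add0n.
have -> : minn e Q = e by lia.
have -> : e - Q = 0 by lia.
by rewrite cats0 nseqD.
Qed.

(** A first run that never shrinks is a soliton moving at speed [Q]. The rest [U] evolves as if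
    alone: at time [s] the soliton has advanced over [s * Q] boxes which are empty in the evolution
    of [U]. *)
Lemma iter_sweep_first_run g Q X V : 0 < Q -> V 0 = false ->
  X = config_cat (nseq g false ++ nseq Q true) V ->
  (forall s e, e < Q -> ~ first_run e (iter s sweep X)) ->
  exists2 U, X = config_cat (soliton_word (g, Q)) U &
  forall s, exists2 V,
    iter s sweep X = config_cat (soliton_word (g + s * Q, Q)) V &
    iter s sweep U = config_cat (nseq (s * Q) false) V.
Proof.
move=> Q0 V0 XE noX.
have [[U VE]|[e eQ]] := first_run_sweep g Q0 V0; last first.
  by rewrite -XE => /(noX 1 e eQ).
exists U; first by rewrite XE VE -config_cat_cat -catA.
elim => [|s [W XsE UsE]].
  exists U; first by rewrite addn0 /= XE VE -config_cat_cat -catA.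
  by apply/funext => k; rewrite /config_cat /= subn0.
have Xs1 : iter s.+1 sweep X =
    config_cat (nseq (g + s.+1 * Q) false ++ nseq Q true) (sweep W).
  rewrite iterS XsE sweep_config_cat ?word_load_soliton// word_sweep_soliton.
  by congr (config_cat (nseq _ _ ++ _)); lia.
have [[W' WE]|[e eQ]] := first_run_sweep (g + s.+1 * Q) Q0 (sweep_at0 W);
  last first.
  by rewrite -Xs1 -iterS => /(noX s.+2 e eQ).
exists W'; first by rewrite Xs1 WE -config_cat_cat -catA.
rewrite iterS UsE sweep_gap WE -config_cat_cat -nseqD;
  congr (config_cat (nseq _ _)).
by lia.
Qed.

Definition has_balls X M := exists K, forall k, K <= k -> count id (mkseq X k) = M.

Lemma count_word_sweep w : count id w = count id (word_sweep w) + word_load w.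
Proof.
elim/last_ind: w => // w x IH.
rewrite word_sweep_rcons word_load_rcons -!cats1 !count_cat /= IH.
by case: x; case: (word_load w) => [|c] /=; lia.
Qed.

Lemma has_balls_supported X M : has_balls X M -> exists K, supported_below X K.
Proof.
move=> [K XK]; exists K => k Kk.
have := XK _ (leqW Kk); rewrite mkseqS -cats1 count_cat XK//=; lia.
Qed.

Lemma supported_has_balls X K : supported_below X K ->
  has_balls X (count id (mkseq X K)).
Proof.
move=> XK; exists K => k /subnKC <-; elim: (k - K) => [|t IH];
  first by rewrite addn0.
by rewrite addnS mkseqS -cats1 count_cat IH /= XK ?leq_addr ?addn0.
Qed.

Lemma has_balls_sweep X M : has_balls X M -> has_balls (sweep X) M.
Proof.
move=> XM; have [K XK] := has_balls_supported XM.
have XK' := supported_below_sweep XK.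
have [K0 XM0] := XM.
exists (K0 + (K + load X K)) => k Kk.
rewrite -(XM0 k); last lia.
rewrite mkseq_sweep [RHS]count_word_sweep -load_mkseq.
suff -> : load X k = 0 by rewrite addn0.
apply/eqP; rewrite -leqn0 leqNgt; apply/negP => h.
by have := XK' k; rewrite /sweep h XK; lia.
Qed.

Lemma has_balls_config_cat u U M : has_balls (config_cat u U) M ->
  exists2 M', has_balls U M' & M = count id u + M'.
Proof.
move=> [K XK]; exists (M - count id u).
  exists K => k Kk; have := XK (size u + k).
  by rewrite mkseq_config_cat count_cat; lia.
have := XK (size u + K); rewrite mkseq_config_cat count_cat; lia.
Qed.

(** If the first run ever shrinks, the inner induction restarts at that time. Otherwise its soliton
    is split off, the rest has fewer balls and stabilises, and it remains to see that the detached
    soliton is no longer than the next one. *)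
Lemma eventually_solitonsP X : (exists M, has_balls X M) -> eventually_solitons X.
Proof.
case=> M; have [n] := ubnP M; elim: n => // n IHn in X M * => Mn XM.
have [X0|] := pselect (forall k, X k = false).
  exists 0, [::]; split=> //=; apply/funext => k.
  by rewrite X0 /soliton_config /= nth_nil.
move=> /existsNP[k0 /eqP]; rewrite eqbF_neg negbK => Xk0.
have [Q [g [V [Q0 V0 XE]]]] : exists Q, first_run Q X.
  have exX : exists k, X k by exists k0.
  have [] := ex_minnP exX => g Xg gmin.
  have [K XK] := has_balls_supported XM.
  have exQ : exists j, ~~ X (g + j) by exists K; rewrite XK// leq_addl.
  have [] := ex_minnP exQ => Q XQ Qmin.
  exists Q, g, (fun k => X (g + Q + k)); split.
  - by case: Q XQ {Qmin} => //; rewrite addn0 Xg.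
  - by rewrite addn0; apply/negbTE.
  - rewrite {1}(config_cat_mkseq X (g + Q)); congr config_cat.
    apply: (@eq_from_nth _ false).
      by rewrite size_mkseq size_cat !size_nseq.
    rewrite size_mkseq => i ik; rewrite nth_mkseq// nth_cat size_nseq.
    case: ltnP => ig; rewrite nth_nseq.
      by rewrite ig; apply/negbTE/negP => /gmin; lia.
    have -> : i - g < Q by lia.
    by apply/negPn/negP; rewrite -(subnKC ig) => /Qmin; lia.
have [m] := ubnP Q; elim: m => // m IHm in Q g V X Q0 V0 XE {k0 Xk0} XM *.
move=> Qm.
have [[s [e [eQ]]]|noX] :=
    pselect (exists s e, e < Q /\ first_run e (iter s sweep X)).
  move=> [g' [V' [e0 V'0 XsE]]].
  have XsM : has_balls (iter s sweep X) M.
    by elim: s {XsE} => //= s IHs; exact: has_balls_sweep.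
  have [s' [L [L1 L2 L3]]] := IHm e g' V' _ e0 V'0 XsE XsM (leq_trans eQ Qm).
  by exists (s' + s), L; split=> //; rewrite iterD.
have [|U XU Xs] := iter_sweep_first_run Q0 V0 XE.
  by move=> s e eQ fr; apply: noX; exists s, e.
have [M' UM' ME] : exists2 M', has_balls U M' & M = Q + M'.
  move: XM; rewrite XU => /has_balls_config_cat[M' UM' ->].
  exists M' => //; rewrite /soliton_word !count_cat !count_nseq /=; lia.
have [|s [L [L1 L2 UL]]] := IHn U M' _ UM'; first lia.
have [W XsW UsW] := Xs s.
case: L L1 L2 UL => [|[g1 l1] L] L1 L2 UL.
  exists s, [:: (g + s * Q, Q)]; split => //=; first by rewrite Q0.
  rewrite XsW soliton_config_cons; congr config_cat.
  apply: (@config_cat_inj (nseq (s * Q) false)); rewrite -UsW UL.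
  rewrite /soliton_config config_cat_nth; apply/funext => k.
  by rewrite /= nth_nil cats0 nth_nseq; case: ifP.
(* The boxes covered by the detached soliton stay empty in the evolution of [U], whose first soliton
   stands at [g1 + t * l1]. *)
have gap t : (s + t) * Q <= g1 + t * l1.
  have [L' L'E] : exists L', iter t (next_gaps 0) ((g1, l1) :: L) =
      (g1 + t * l1, l1) :: L'.
    elim: t => [|t [L' IHt]]; first by exists L; rewrite addn0.
    by rewrite iterS IHt /=; eexists; congr ((_, _) :: _); lia.
  have := (iter_sweep_soliton_config t L2).1; rewrite L'E -UL -iterD addnC.
  have [W' _ ->] := Xs (s + t) => /(congr1 (fun X => X (g1 + t * l1))).
  rewrite /config_cat size_nseq nth_nseq.
  case: ltnP => // _ /esym.
  rewrite soliton_config_cons /config_cat /soliton_word /= !size_cat !size_nseq.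
  move: L1 => /= /andP[l10 _].
  have -> : g1 + t * l1 < g1 + t * l1 + (l1 + l1) by lia.
  by rewrite nth_cat size_nseq ltnn subnn; case: (l1) l10.
have Ql1 : Q <= l1.
  (* A faster soliton on the left would gain at least one box per sweep and cross the gap [g1]
     within [g1.+1] sweeps. *)
  rewrite leqNgt; apply/negP => lQ; have := gap g1.+1; nia.
have sg : s * Q <= g1 by have := gap 0; rewrite !addn0.
exists s, [:: (g + s * Q, Q), (g1 - s * Q, l1) & L]; split => //=.
- by rewrite Q0.
- by rewrite Ql1.
rewrite XsW soliton_config_cons; congr config_cat.
apply: (@config_cat_inj (nseq (s * Q) false)); rewrite -UsW UL.
rewrite !soliton_config_cons -config_cat_cat; congr config_cat.
by rewrite /soliton_word /= [RHS]catA -nseqD subnKC.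
Qed.

(** Stabilisation excludes the default value of [xget]; conservation then computes the count for
    whichever stable sequence [xget] returns. *)
Lemma nb_solitons_geE m w :
  nb_solitons_ge m.+1 (nth false w) = nb_overflow_runs m w.
Proof.
have wK : supported_below (nth false w) (size w) by move=> k; exact: nth_default.
have [s0 [L [L1 sL wL]]] : eventually_solitons (nth false w).
  by apply: eventually_solitonsP; eexists; exact: supported_has_balls wK.
have ex : exists s0, forall s, s0 <= s ->
    stable_with (iter s sweep (nth false w)) (unzip2 L).
  exists s0 => s /subnK <-; rewrite iterD wL.
  have [-> e2] := iter_sweep_soliton_config (s - s0) sL; rewrite -e2.
  by apply: soliton_config_stable; rewrite e2.
rewrite /nb_solitons_ge /soliton_lengths; case: xgetP => [ls _ [s1 stab]|].
  have [K1 XK1 <-] := nb_overflow_runs_stable m (stab s1 (leqnn _)).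
  have [K2 XK2 E2] := nb_overflow_runs_iter_sweep m s1 wK.
  rewrite -(nb_overflow_runs_supported _ XK1 (leq_addr K2 K1)).
  rewrite (nb_overflow_runs_supported _ XK2 (leq_addl K1 K2)) E2.
  by rewrite mkseq_nth.
by move=> /(_ (unzip2 L)); case.
Qed.

End stabilisation.

(** * Law of large numbers *)

Section word_law.
Context {R : realType}.
Implicit Types (p : R) (G H : seq bool -> R).

Definition word_of_steps (x : nat -> R) n : seq bool := mkseq (fun k => x k == 1) n.

Lemma word_of_stepsS x n : word_of_steps x n.+1 =
  rcons (word_of_steps x n) (x n == 1).
Proof. exact: mkseqS. Qed.

Lemma size_word_of_steps x n : size (word_of_steps x n) = n.
Proof. exact: size_mkseq. Qed.

Lemma rhoE m n x : rho m.+1 n x = nb_overflow_runs m (word_of_steps x n).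
Proof.
rewrite /rho -nb_solitons_geE; congr nb_solitons_ge; apply/funext => k.
rewrite /config_of_steps; case: ltnP => kn; first by rewrite nth_mkseq.
by rewrite nth_default// size_mkseq.
Qed.

(* Expectation of [G] at a word of [n] independent letters, each of which is
   [true] with probability [p]. *)
Fixpoint mean p n G : R :=
  if n is n'.+1 then
    mean p n' (fun u => p * G (rcons u true) + (1 - p) * G (rcons u false))
  else G [::].

Lemma eq_mean p n G H : (forall u, size u = n -> G u = H u) ->
  mean p n G = mean p n H.
Proof.
elim: n G H => [|n IH] G H GH /=; first exact: GH.
by apply: IH => u un; rewrite !GH// size_rcons un.
Qed.

Lemma meanD p n G H : mean p n (fun u => G u + H u) = mean p n G + mean p n H.
Proof.
elim: n G H => //= n IH G H; rewrite -IH; apply: eq_mean => u _; ring.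
Qed.

Lemma meanZ p n c G : mean p n (fun u => c * G u) = c * mean p n G.
Proof.
elim: n G => //= n IH G; rewrite -IH; apply: eq_mean => u _; ring.
Qed.

Lemma mean_cst p n c : mean p n (fun=> c) = c.
Proof.
elim: n => //= n IH; rewrite -[RHS]IH; apply: eq_mean => u _; ring.
Qed.

Lemma ler_mean p n G H : 0 <= p <= 1 -> (forall u, size u = n -> G u <= H u) ->
  mean p n G <= mean p n H.
Proof.
move=> /andP[p0 p1]; elim: n G H => [|n IH] G H GH /=; first exact: GH.
by apply: IH => u un; rewrite lerD// ler_wpM2l ?subr_ge0 ?GH ?size_rcons ?un.
Qed.

End word_law.

(** * From independent steps to means over words *)

Section iid_words.
Context d (T : measurableType d) (R : realType) (P : probability T R).
Context (p : R) (X : nat -> {RV P >-> R}).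
Hypothesis X_iid : iid X.
Hypothesis X_up : P [set w | X 0%N w = 1] = p%:E.

Let word n w := word_of_steps (fun k => X k w) n.

Lemma measurable_step_up k : measurable [set w | X k w = 1].
Proof.
rewrite -[X in measurable X]setTI.
exact: (measurable_funP (X k)) measurableT _ (measurable_set1 1).
Qed.

Lemma measurable_word n (Q : pred (seq bool)) : measurable [set w | Q (word n w)].
Proof.
elim: n Q => [|n IH] Q.
  case QE : (Q [::]).
    by rewrite (_ : [set _ | _] = setT)//; apply/seteqP; split => w //= _.
  by rewrite (_ : [set _ | _] = set0)//; apply/seteqP; split => w //=; rewrite QE.
rewrite (_ : [set _ | _] =
    ([set w | Q (rcons (word n w) true)] `&` [set w | X n w = 1]) `|`
    ([set w | Q (rcons (word n w) false)] `\` [set w | X n w = 1])).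
  apply: measurableU.
    by apply: measurableI; [exact: (IH (fun u =>
      Q (rcons u true)))|exact: measurable_step_up].
  by apply: measurableD; [exact: (IH (fun u =>
    Q (rcons u false)))|exact: measurable_step_up].
apply/seteqP; split => w /=; rewrite /word word_of_stepsS.
  by case: eqP => h; [left|right].
by move=> [[h ->]|[h /eqP/negbTE ->]] //; rewrite eqxx.
Qed.

Lemma prob_step_up k : P (X k @^-1` [set 1]) = p%:E.
Proof.
rewrite -X_up; have /(_ k [set 1]) := X_iid.2.
by rewrite /distribution /pushforward; apply; exact: measurable_set1.
Qed.

Lemma prob_step_not_up k : P (X k @^-1` ~` [set 1]) = (1 - p)%:E.
Proof.
by rewrite -preimage_setC probability_setC ?prob_step_up//.
Qed.

(** The cylinder over later indices is what lets the induction on [n] run: the last letter of the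
    word is moved into it, and independence is applied to [n :: J]. *)
Lemma prob_word_cylinder n (Q : pred (seq bool)) J (A : nat -> set R) :
  uniq J -> all (leq n) J -> (forall j, measurable (A j)) ->
  P ([set w | Q (word n w)] `&` \big[setI/setT]_(j <- J) (X j @^-1` A j)) =
  ((mean p n (fun u => (Q u)%:R))%:E * P (\big[setI/setT]_(j <- J) (X j @^-1` A
    j)))%E.
Proof.
have mC I (B : nat -> set R) : (forall j, measurable (B j)) ->
    measurable (\big[setI/setT]_(j <- I) (X j @^-1` B j)).
  move=> mB; elim: I => [|i I IH]; first by rewrite big_nil.
  rewrite big_cons; apply: measurableI => //.
  by rewrite -[X in measurable X]setTI; exact: (measurable_funP (X i)).
elim: n Q J A => [|n IH] Q J A uJ nJ mA.
  rewrite /= (_ : [set _ | _] = if Q [::] then setT else set0).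
    by case: (Q [::]); rewrite ?setTI ?mul1e// set0I measure0 mul0e.
  by apply/seteqP; split => w /=; case: (Q [::]).
set C := \big[_/_]_(_ <- _) _.
have nnJ : n \notin J by apply/negP => /(allP nJ); rewrite ltnn.
pose A' (B : set R) j := if j == n then B else A j.
have mA' B : measurable B -> forall j, measurable (A' B j).
  by move=> mB j; rewrite /A'; case: ifP.
have bigA' B : \big[setI/setT]_(j <- n :: J) (X j @^-1` A' B j) =
  (X n @^-1` B) `&` C.
  rewrite big_cons /A' eqxx; congr (_ `&` _); apply: eq_big_seq => j jJ.
  by rewrite ifF//; apply: contraNF nnJ => /eqP <-.
have unJ : uniq (n :: J) by rewrite /= nnJ.
have lnJ : all (leq n) (n :: J).
  by rewrite /= leqnn; apply: sub_all nJ => j /ltnW.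
have PA' B : measurable B -> P ((X n @^-1` B) `&` C) = (P (X n @^-1` B) * P C)%E.
  move=> mB; rewrite -bigA' (X_iid.1 _ _ unJ (mA' B mB)) big_cons /A' eqxx.
  congr (_ * _)%E; rewrite /C (X_iid.1 _ _ uJ mA); apply: eq_big_seq => j jJ.
  by rewrite ifF//; apply: contraNF nnJ => /eqP <-.
have m1 := measurable_set1 (1 : R).
have m1C := measurableC m1.
pose Q1 b u := Q (rcons u b).
have IHB b B : measurable B ->
    P ([set w | Q1 b (word n w)] `&` ((X n @^-1` B) `&` C)) =
    ((mean p n (fun u => (Q1 b u)%:R))%:E * (P (X n @^-1` B) * P C))%E.
  by move=> mB; rewrite -PA'// -bigA' IH// => j; exact: mA'.
rewrite (_ : _ `&` C =
   ([set w | Q1 true (word n w)] `&` ((X n @^-1` [set 1]) `&` C)) `|`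
   ([set w | Q1 false (word n w)] `&` ((X n @^-1` ~` [set 1]) `&` C))); last first.
  apply/seteqP; split => w /=; rewrite /word word_of_stepsS /Q1.
    by case: eqP => h [q c]; [left|right].
  by move=> [[q [-> c]]|[q [/eqP/negbTE -> c]]]; rewrite ?eqxx.
have mD b B : measurable B ->
    measurable ([set w | Q1 b (word n w)] `&` ((X n @^-1` B) `&` C)).
  move=> mB; apply: measurableI; first exact: measurable_word.
  apply: measurableI; last exact: mC.
  by rewrite -[X in measurable X]setTI; exact: (measurable_funP (X n)).
set D1 := _ `&` _; set D2 := _ `&` (_ `&` _).
have -> : P (D1 `|` D2) = (P D1 + P D2)%E.
  apply: measureU; [exact: mD|exact: mD|].
  by apply/seteqP; split => w //= -[[_ [e _]] [_ [h _]]]; exact: h e.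
rewrite (IHB true _ m1) (IHB false _ m1C) prob_step_up prob_step_not_up.
have -> : P C = (fine (P C))%:E by rewrite fineK// fin_num_measure//; exact: mC.
rewrite -!EFinM -EFinD; congr EFin => /=; rewrite meanD !meanZ /Q1; ring.
Qed.

Lemma prob_word n (Q : pred (seq bool)) :
  P [set w | Q (word n w)] = (mean p n (fun u => (Q u)%:R))%:E.
Proof.
have := @prob_word_cylinder n Q [::] (fun=> setT) isT isT (fun=> measurableT).
by rewrite big_nil setIT probability_setT mule1.
Qed.

End iid_words.

(** From [1 - x <= expR (- x)], the exponential is at most [(1 - x)^-1], which the quadratic
    dominates for [x <= 2^-1]. *)
Lemma expR_le_quadratic (R : realType) (x : R) :
  `|x| <= 2^-1 -> expR x <= 1 + x + 2 * x ^+ 2.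
Proof.
move=> x2; have [xl xu] : - 2^-1 <= x /\ x <= 2^-1 by apply/andP;
  rewrite -ler_norml.
have h := expR_ge1Dx (- x).
have x1 : 0 < 1 - x by lra.
rewrite -[X in expR X]opprK expRN.
apply: (@le_trans _ _ (1 - x)^-1).
  by rewrite lef_pV2 ?posrE ?expR_gt0//.
rewrite -[leLHS]mul1r ler_pdivrMr//.
have : 0 <= x ^+ 2 * (1 - 2 * x) by rewrite mulr_ge0 ?sqr_ge0//; lra.
lra.
Qed.

(** * Exponential inequality for martingales with bounded increments *)

Section bounded_martingale.
Context (R : realType) (p : R) (p01 : 0 <= p <= 1).
Context (M : seq bool -> R) (c : R).
Hypothesis c_gt0 : 0 < c.
Hypothesis M_mean : forall u, p * M (rcons u true) + (1 - p) * M (rcons u false) =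
  M u.
Hypothesis M_bound : forall u b, `|M (rcons u b) - M u| <= c.

Lemma mean_expR_martingale t n : `|t| * c <= 2^-1 ->
  mean p n (fun u => expR (t * (M u - M [::]))) <= expR (2 * (t * c) ^+ 2 *+ n).
Proof.
move=> tc; elim: n => [|n IH]; first by rewrite /= subrr mulr0 mulr0n.
have [p0 p1] := andP p01.
rewrite mulrS expRD; apply: le_trans (ler_wpM2l (expR_ge0 _) IH).
rewrite -meanZ /=; apply: ler_mean => // u _.
have step b : expR (t * (M (rcons u b) - M [::])) <=
    expR (t * (M u - M [::])) *
      (1 + t * (M (rcons u b) - M u) + 2 * (t * c) ^+ 2).
  have -> : t * (M (rcons u b) - M [::]) =
    t * (M u - M [::]) + t * (M (rcons u b) - M u) by ring.
  rewrite expRD ler_wpM2l ?expR_ge0//.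
  have tM : `|t * (M (rcons u b) - M u)| <= `|t| * c.
    by rewrite normrM ler_wpM2l.
  apply: le_trans (expR_le_quadratic (le_trans tM tc)) _.
  have -> : (t * c) ^+ 2 = (`|t| * c) ^+ 2.
    by rewrite !exprMn real_normK ?num_real.
  rewrite lerD2l ler_wpM2l// -[leLHS]real_normK ?num_real//.
  by rewrite lerXn2r// nnegrE mulr_ge0// ltW.
apply: le_trans (lerD (ler_wpM2l p0 (step true)) (ler_wpM2l _ (step false))) _.
  by rewrite subr_ge0.
set E := expR (t * _).
have -> : p * (E * (1 + t * (M (rcons u true) - M u) + 2 * (t * c) ^+ 2)) +
  (1 - p) * (E * (1 + t * (M (rcons u false) - M u) + 2 * (t * c) ^+ 2)) =
  E * (1 + t * (p * M (rcons u true) + (1 - p) * M (rcons u false) - M u) +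
        2 * (t * c) ^+ 2) by ring.
rewrite M_mean subrr mulr0 addr0 mulrC ler_wpM2r ?expR_ge0//.
exact: expR_ge1Dx.
Qed.

Lemma martingale_deviation (e : R) : 0 < e -> exists2 r : R, 0 <= r < 1 & forall n,
  mean p n (fun u => (e *+ n <= `|M u - M [::]|)%R%:R) <= 2 * r ^+ n.
Proof.
(* The first bound makes the quadratic estimate of [expR] applicable; the second keeps the variance
   term [2 * (t * c) ^+ 2] below half of the gain [t * e]. *)
move=> e_gt0; pose t := Num.min (2 * c)^-1 (e / (4 * c ^+ 2)).
have c2 : 0 < 4 * c ^+ 2 by rewrite mulr_gt0// exprn_gt0.
have t0 : 0 < t by rewrite lt_min invr_gt0 mulr_gt0//= divr_gt0.
have t1 : t * c <= 2^-1.
  rewrite -ler_pdivlMr// -invfM /t ge_min mulrC.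
  by rewrite lexx.
have t2 : 2 * (t * c) ^+ 2 <= t * e / 2.
  have : t * (4 * c ^+ 2) <= e by rewrite -ler_pdivlMr// /t ge_min lexx orbT.
  by move=> /(ler_wpM2l (ltW t0)); lra.
exists (expR (- (t * e / 2))).
  by rewrite expR_ge0 expR_lt1 oppr_lt0 divr_gt0// mulr_gt0.
move=> n; rewrite -expRM_natl.
have bound s : `|s| = t -> mean p n (fun u => expR (s * (M u - M [::]))) <=
  expR (t * e / 2 *+ n).
  move=> st; have := @mean_expR_martingale s n; rewrite st => /(_ t1) /le_trans;
    apply.
  rewrite ler_expR lerMn2r; apply/orP; right.
  apply: le_trans t2.
  rewrite ler_wpM2l// !exprMn -(real_normK (num_real s)) st lexx//.
have ge u : (e *+ n <= `|M u - M [::]|)%R%:R <=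
    expR (- (t * e *+ n)) * expR (t * (M u - M [::])) +
    expR (- (t * e *+ n)) * expR (- t * (M u - M [::])).
  rewrite -!expRD; case: (boolP (e *+ n <= _)%R) => h; last first.
    by apply: addr_ge0; exact: expR_ge0.
  have e1 z : e *+ n <= z -> 1 <= expR (- (t * e *+ n) + t * z).
    move=> ez; rewrite -[leLHS]expR0 ler_expR addrC subr_ge0 -mulrnAr.
    by rewrite ler_wpM2l// ltW.
  have [Mu|Mu] := leP 0 (M u - M [::]).
    by rewrite ger0_norm// in h; rewrite -[leLHS]addr0 lerD ?expR_ge0// e1.
  rewrite ltr0_norm// in h; rewrite -[leLHS]add0r lerD ?expR_ge0//.
  by rewrite mulNr -mulrN e1.
apply: le_trans (ler_mean p01 (fun u _ => ge u)) _.
rewrite meanD !meanZ -mulrDr.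
have bt : mean p n (fun u => expR (t * (M u - M [::]))) +
    mean p n (fun u => expR (- t * (M u - M [::]))) <= 2 * expR (t * e / 2 *+ n).
  by rewrite [2 * _]mulrDl !mul1r lerD// bound// ?normrN gtr0_norm.
apply: le_trans (ler_wpM2l (expR_ge0 _) bt) _.
rewrite mulrCA ler_wpM2l// -expRD ler_expR -[_ *+ n]mulr_natl -[_ / 2 *+
  n]mulr_natl.
by lra.
Qed.

End bounded_martingale.

(** * Almost sure convergence by the Borel-Cantelli lemma *)

Section strong_law.
Context d (T : measurableType d) (R : realType) (P : probability T R).
Context (p : R) (X : nat -> {RV P >-> R}).
Hypothesis X_iid : iid X.
Hypothesis X_up : P [set w | X 0%N w = 1] = p%:E.
Hypothesis p01 : 0 <= p <= 1.

Let word n w := word_of_steps (fun k => X k w) n.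

Lemma ae_cvg_martingale (S M : seq bool -> R) (q c K : R) : 0 < c ->
  (forall u, p * M (rcons u true) + (1 - p) * M (rcons u false) = M u) ->
  (forall u b, `|M (rcons u b) - M u| <= c) ->
  (forall u, `|S u - q *+ size u - M u| <= K) ->
  {ae P, forall w, S (word n w) / n%:R @[n --> \oo] --> q}.
Proof.
move=> c0 M_mean M_bound SM.
pose F (e : R) n := [set w | e *+ n <= `|M (word n w) - M [::]|].
have mF e n : measurable (F e n).
  exact: (measurable_word X n (fun u => e *+ n <= `|M u - M [::]|)).
have F0 e : 0 < e -> P (lim_sup_set (F e)) = 0%E.
  move=> e0; apply: lim_sup_set_cvg0 => //.
  have [r /andP[r0 r1] Pr] := martingale_deviation p01 c0 M_mean M_bound e0.
  apply: (@le_lt_trans _ _ (2 / (1 - r))%:E); last exact: ltry.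
  apply: lime_le; first by apply: is_cvg_nneseries.
  apply: nearW => n /=; apply: (@le_trans _ _ (\sum_(0 <=
    k < n) (2 * r ^+ k)%:E)%E).
    apply: lee_sum => k _.
    rewrite /F (prob_word X_iid X_up k (fun u => e *+ k <= `|M u - M [::]|)).
    by rewrite lee_fin.
  rewrite sumEFin lee_fin -mulr_sumr ler_pM2l// big_mkord.
  rewrite -[leRHS]mul1r ler_pdivlMr ?subr_gt0//.
  have := subrX1 r n; have : 0 <= r ^+ n by rewrite exprn_ge0.
  move: (\sum_(_ < _) _) => s; lra.
(* Countably many precisions suffice, so the exceptional set is a countable union of null sets. *)
pose N := \bigcup_j lim_sup_set (F j.+1%:R^-1).
have mlim e : measurable (lim_sup_set (F e)).
  by apply: bigcapT_measurable => n; exact: bigcup_measurable.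
have N0 : P.-negligible N.
  apply: negligible_bigcup => j; apply/negligibleP => //.
  by apply: F0.
apply: negligibleS N0 => w /= nS; apply: contrapT => nN; apply: nS.
apply/cvgrPdist_lt => e e0.
have [j je] : exists j : nat, j.+1%:R^-1 < e / 2.
  have e20 : 0 < e / 2 by rewrite divr_gt0.
  exists (Num.trunc (e / 2)^-1).
  rewrite invf_plt ?posrE//; apply: truncnS_gt.
have [n0 n0F] : exists n0, forall n, (n0 <= n)%N -> ~ F j.+1%:R^-1 n w.
  apply: contrapT => nF; apply: nN; exists j => // n0 _.
  apply: contrapT => nF'; apply: nF; exists n0 => n n0n Fn.
  by apply: nF'; exists n.
pose C := K + `|M [::]|.
near=> n.
have n_gt0 : (0 < n)%N by near: n; exact: nbhs_infty_gt.
have nn0 : 0 < n%:R :> R by rewrite ltr0n.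
have nF : ~ F j.+1%:R^-1 n w.
  by apply: n0F; near: n; exact: nbhs_infty_ge.
have Cn : C < e / 2 * n%:R.
  rewrite -ltr_pdivrMl ?divr_gt0//; near: n; exact: nbhs_infty_gtr.
have -> : q - S (word n w) / n%:R = (q * n%:R - S (word n w)) / n%:R.
  by rewrite mulrBl mulfK// gt_eqF.
rewrite normf_div (gtr0_norm nn0) ltr_pdivrMr//.
have /negP := nF; rewrite -ltNge /= => nF'.
have := SM (word n w); rewrite size_word_of_steps -[q *+ n]mulr_natr => SMw.
rewrite distrC.
have -> : S (word n w) - q * n%:R = (S (word n w) - q * n%:R - M (word n w)) +
  (M (word n w) - M [::]) + M [::] by ring.
apply: le_lt_trans (ler_normD _ _) _.
apply: le_lt_trans (lerD (ler_normD _ _) (lexx _)) _.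
have : j.+1%:R^-1 *+ n < e / 2 * n%:R by rewrite -[_ *+ n]mulr_natr ltr_pM2r.
move: nF' SMw Cn; rewrite /C; set a := `|M _ - _|; set b := `|S _ - _ - _|.
have -> : e * n%:R = e / 2 * n%:R + e / 2 * n%:R by rewrite -mulrDl -splitr.
rewrite -/b; move: (_ *+ n) (e / 2 * _) => x y; lra.
Unshelve. all: by end_near. Qed.

End strong_law.

(** * The Poisson equation of the carrier *)

Section soliton_density.
Context (R : realType) (p : R).
Hypotheses (p_gt0 : 0 < p) (p_lt1 : p < 1).

(** Kept as a sum because the closed form breaks down at [r = 1], that is, at p = 1/2. *)
Definition geom_sum (r : R) j := \sum_(k < j.+1) r ^+ k.

Lemma geom_sum0 r : geom_sum r 0 = 1.
Proof. by rewrite /geom_sum big_ord1. Qed.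

Lemma geom_sumSr r j : geom_sum r j.+1 = geom_sum r j + r ^+ j.+1.
Proof. by rewrite /geom_sum big_ord_recr. Qed.

Lemma geom_sumS r j : geom_sum r j.+1 = 1 + r * geom_sum r j.
Proof.
rewrite /geom_sum big_ord_recl expr0 mulr_sumr; congr (_ + _).
by apply: eq_bigr => i _; rewrite exprS.
Qed.

Let r := (1 - p) / p.

Let r_gt0 : 0 < r. Proof. by rewrite divr_gt0// subr_gt0. Qed.

Lemma geom_sum_gt0 j : 0 < geom_sum r j.
Proof.
elim: j => [|j IH]; first by rewrite geom_sum0.
by rewrite geom_sumS addr_gt0// mulr_gt0.
Qed.

(* The probability that a path with steps +1 and -1 makes a positive excursion
   of height exactly [m + 1] (gambler's ruin). *)
Definition soliton_density m :=
  p * r ^+ m.+1 / (geom_sum r m * geom_sum r m.+1).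

Lemma soliton_density_gt0 m : 0 < soliton_density m.
Proof. by rewrite divr_gt0 ?mulr_gt0 ?exprn_gt0 ?geom_sum_gt0. Qed.

(* A solution of the Poisson equation of the Markov chain formed by the load [v]
   of the carrier of capacity [m] and the last overflow letter [b]: the
   difference between its two components is a ruin probability. *)
Definition corrector m v (b : bool) :=
  soliton_density m / p * (\sum_(j < v) geom_sum r j) -
  b%:R * (geom_sum r v / geom_sum r m.+1).

Let h m v := corrector m v false.

Let hS m v : h m v.+1 = h m v + soliton_density m / p * geom_sum r v.
Proof. by rewrite /h /corrector big_ord_recr /=; ring. Qed.

Definition run_martingale m u :=
  (nb_overflow_runs m u)%:R - soliton_density m *+ size u +
  corrector m (carrier_load m u) (last false (overflow m u)).

Let run_martingale_rcons m u x : run_martingale m (rcons u x) - run_martingale m u =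
  let v := carrier_load m u in let b := last false (overflow m u) in
  (if x then if (v < m)%N then corrector m v.+1 b
             else (~~ b)%:R + corrector m v true
   else if (0 < v)%N then corrector m v.-1 b else corrector m 0 false) -
  corrector m v b - soliton_density m.
Proof.
rewrite /run_martingale /nb_overflow_runs overflow_rcons carrier_load_rcons.
rewrite size_rcons mulrS.
have := carrier_load_le m u; move: (carrier_load m u) => v vm.
case: x; case: ifP => h0 /=.
- ring.
- by rewrite nb_runs_rcons andbT last_rcons natrD; ring.
- ring.
- have -> : v = 0%N by lia.
  by rewrite nb_runs_rcons0 last_rcons /=; ring.
Qed.

(** With g = [geom_sum r], the relation g(v) - r g(v - 1) = 1 gives the part free of [b] the
    constant drift [soliton_density m]. The factor of [b] is harmonic: g(v) / g(m + 1) is the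
    probability that an overflowing ball comes before an overflowing empty box. *)
Lemma run_martingale_mean m u :
  p * run_martingale m (rcons u true) + (1 - p) * run_martingale m (rcons u false)
  = run_martingale m u.
Proof.
apply/eqP; rewrite -subr_eq0; apply/eqP.
have -> : p * run_martingale m (rcons u true) +
    (1 - p) * run_martingale m (rcons u false) - run_martingale m u =
  p * (run_martingale m (rcons u true) - run_martingale m u) +
  (1 - p) * (run_martingale m (rcons u false) - run_martingale m u) by ring.
rewrite !run_martingale_rcons /=.
have := carrier_load_le m u; move: (carrier_load m u) (last _ _) => v b vm.
have p0 : p != 0 by rewrite gt_eqF.
have sm0 : geom_sum r m != 0 by rewrite gt_eqF// geom_sum_gt0.
have sm10 : geom_sum r m.+1 != 0 by rewrite gt_eqF// geom_sum_gt0.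
set k := soliton_density m / p.
have kp : soliton_density m = k * p by rewrite divfK.
have corrE j c : corrector m j c = h m j - c%:R * (geom_sum r j / geom_sum r m.+1).
  by rewrite /h /corrector /=; ring.
(* The boundary condition at full load; it determines the value of the density. *)
have kE : k * geom_sum r m = 1 - geom_sum r m / geom_sum r m.+1.
  have sE : r ^+ m.+1 = geom_sum r m.+1 - geom_sum r m by rewrite geom_sumSr; ring.
  by rewrite /k /soliton_density sE; field; rewrite ?p0 ?sm0 ?sm10.
have -> : (if (v < m)%N then corrector m v.+1 b else (~~ b)%:R + corrector m v
  true) =
    h m v + k * geom_sum r v - b%:R * (geom_sum r v.+1 / geom_sum r m.+1).
  case: ltnP => hv; first by rewrite corrE hS.
  have -> : v = m by lia.
  rewrite kE divff// corrE; case: (b) => /=; ring.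
have rE : 1 - p = r * p by rewrite divfK.
have pr : p + r * p = 1 by rewrite -rE addrC subrK.
rewrite corrE kp rE; transitivity (k * p * (1 - (p + r * p))); last first.
  by rewrite pr subrr mulr0.
case: v vm => [|v] vm /=.
  rewrite corrE (geom_sumS r 0) geom_sum0.
  move: (_^-1) (h m 0) => i z /=; ring.
rewrite corrE hS -/k (geom_sumS r v.+1) (geom_sumS r v).
move: (geom_sum r m.+1)^-1 (h m v) => i z; ring.
Qed.

Lemma corrector_bound m v b : (v <= m)%N ->
  `|corrector m v b| <= soliton_density m / p * (\sum_(j < m) geom_sum r j) + 1.
Proof.
move=> vm; rewrite /corrector; apply: le_trans (ler_normB _ _) _.
have d0 : 0 <= soliton_density m / p by rewrite ltW// divr_gt0//
  soliton_density_gt0.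
have g0 j : 0 <= geom_sum r j by exact/ltW/geom_sum_gt0.
have gmono i : (i <= m.+1)%N -> geom_sum r i <= geom_sum r m.+1.
  move=> /subnKC <-; elim: (_ - _)%N => [|j IH]; first by rewrite addn0.
  by rewrite addnS geom_sumSr; apply: le_trans IH _; rewrite lerDl exprn_ge0// ltW.
apply: lerD.
  rewrite ger0_norm; last by rewrite mulr_ge0// sumr_ge0.
  rewrite ler_wpM2l// -(subnKC vm) big_split_ord /= lerDl.
  by apply: sumr_ge0.
have q1 : geom_sum r v / geom_sum r m.+1 <= 1.
  by rewrite ler_pdivrMr ?geom_sum_gt0// mul1r gmono// leqW.
have q0 : 0 <= geom_sum r v / geom_sum r m.+1 by rewrite divr_ge0.
by case: b; rewrite ?mul1r ?mul0r ?normr0 ?ger0_norm.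
Qed.

Lemma run_martingale_bound m : exists2 c : R, 0 < c &
  forall u b, `|run_martingale m (rcons u b) - run_martingale m u| <= c.
Proof.
set C := soliton_density m / p * (\sum_(j < m) geom_sum r j) + 1.
have C0 : 0 <= C.
  exact: le_trans (normr_ge0 _) (corrector_bound true (leq0n m)).
have D0 := ltW (soliton_density_gt0 m).
exists (1 + C + C + soliton_density m).
  by rewrite ltr_wpDr// -addrA ltr_pwDl// addr_ge0.
move=> u x; rewrite run_martingale_rcons /=.
have := carrier_load_le m u; move: (carrier_load m u) (last _ _) => v b vm.
apply: le_trans (ler_normB _ _) _; apply: lerD; last by rewrite ger0_norm.
apply: le_trans (ler_normB _ _) _; apply: lerD; last exact: corrector_bound.
have C1 : C <= 1 + C by rewrite lerDr.
case: x; case: ifP => h'.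
- exact: le_trans (corrector_bound _ h') C1.
- apply: le_trans (ler_normD _ _) _; apply: lerD; last exact: corrector_bound.
  by case: (b); rewrite /= ?normr0 ?normr1.
- by apply: le_trans (corrector_bound _ _) C1; lia.
- exact: le_trans (corrector_bound _ _) C1.
Qed.

Lemma ae_cvg_rho d (T : measurableType d) (P : probability T R)
    (X : nat -> {RV P >-> R}) m : iid X -> P [set w | X 0%N w = 1] = p%:E ->
  {ae P, forall w, (rho m.+1 n (fun k => X k w))%:R / n%:R @[n --> \oo]
     --> soliton_density m}.
Proof.
move=> X_iid X_up.
have p01 : 0 <= p <= 1 by rewrite !ltW.
have [c c0 Mc] := run_martingale_bound m.
have H := ae_cvg_martingale X_iid X_up p01 (S := fun u => (nb_overflow_runs m u)%:R)
  c0 (run_martingale_mean m) Mc.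
have {}H := H (soliton_density m) (soliton_density m / p * (\sum_(j < m) geom_sum
  r j) + 1).
apply: filterS (H _) => [w /=|u].
  by under eq_fun do rewrite -rhoE.
apply: le_trans (corrector_bound (last false (overflow m u)) (carrier_load_le m u)).
rewrite -normrN /run_martingale le_eqVlt; apply/orP; left; apply/eqP.
by congr `|_|; ring.
Qed.

End soliton_density.

(** * Excursions of given height *)

Section first_excursion.
Context {R : realType}.
Implicit Types (x : nat -> R) (n k i : nat).

Lemma le_return_time x k : (k%:R%:E <= return_time x)%E <->
  (forall j, (0 < j)%N -> walk x j = 0 -> (k <= j)%N).
Proof.
split=> [kx j j0 xj|kx].
  have : (return_time x <= j%:R%:E)%E by apply: ereal_inf_lbound; exists j.
  by move=> /(le_trans kx); rewrite lee_fin ler_nat.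
by apply: le_ereal_inf_tmp => _ [j [j0 xj] <-]; rewrite lee_fin ler_nat kx.
Qed.

Lemma max_until_return_ge x k :
  (forall j, (0 < j)%N -> walk x j = 0 -> (k <= j)%N) ->
  ((walk x k)%:E <= max_until_return x)%E.
Proof. by move=> kx; apply: ereal_sup_ubound; exists k => //;
  apply/le_return_time. Qed.

Lemma max_until_return_le x (c : R) :
  (forall k, (forall j, (0 < j)%N -> walk x j = 0 -> (k <= j)%N) -> walk x k <=
    c) ->
  (max_until_return x <= c%:E)%E.
Proof.
by move=> xc; apply: ge_ereal_sup => _ [k /le_return_time kx <-];
  rewrite lee_fin xc.
Qed.

Lemma walkS x k : walk x k.+1 = walk x k + x k.
Proof. by rewrite /walk big_ord_recr. Qed.

Lemma walk0 x : walk x 0 = 0.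
Proof. by rewrite /walk big_ord0. Qed.

(* State of the scan of a path looking for a positive excursion of height [i]:
   [Inside l b] means that the path has not yet returned to 0, is at level [l],
   and that [b] tells whether level [i] has been visited. *)
Inductive scan_state := Start | Inside of nat & bool | Success | Failure.

(** A first step down decides against a height [i >= 1] at once, as does a visit to level [i.+1]. *)
Definition scan_step i s (up : bool) := match s with
  | Start => if up then Inside 1 (1 == i)%N else Failure
  | Inside l b =>
      if up then if (l < i)%N then Inside l.+1 (b || (l.+1 == i)) else Failure
      else if l is l'.+2 then Inside l'.+1 b else if b then Success else Failure
  | Success => Success
  | Failure => Failure
  end.

Definition scan i u := foldl (scan_step i) Start u.

Lemma scan_rcons i u up : scan i (rcons u up) = scan_step i (scan i u) up.
Proof. exact: foldl_rcons. Qed.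

Definition scan_success s := if s is Success then true else false.

Definition scan_live s := match s with Start | Inside _ _ => true | _ => false end.

Lemma scan_inside i u l b : (0 < i)%N -> scan i u = Inside l b ->
  [/\ (0 < l)%N, (l <= i)%N & ~~ b -> (l < i)%N].
Proof.
move=> i0; elim/last_ind: u l b => // u up IH l b.
rewrite scan_rcons; case: (scan i u) IH => //= [|l' b'] IH.
  by case: up => // -[<- <-]; split => //; lia.
have [l'0 l'i b'i] := IH _ _ erefl.
case: up.
  case: ltnP => // l'i' [<- <-]; split => //.
  by rewrite negb_or => /andP[_]; lia.
case: l' l'0 l'i b'i {IH} => [//|[|l']] l'0 l'i b'i; first by case: b' b'i.
by move=> [<- <-]; split => //; try move/b'i; lia.
Qed.

(** Steps have size 1 and the walk is integer-valued, so it stays at or below -1 strictly between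
    time 0 and its return. *)
Lemma walk_negative_excursion x k : (forall j, x j = 1 \/ x j = -1) -> x 0%N = -1 ->
  (forall j, (0 < j)%N -> walk x j = 0 -> (k <= j)%N) -> walk x k <= 0.
Proof.
move=> x1 x0 kx.
have walk_int j : exists z : int, walk x j = z%:~R.
  elim: j => [|j [z IH]]; first by exists 0; rewrite walk0.
  rewrite walkS IH; case: (x1 j) => ->.
    by exists (z + 1); rewrite intrD.
  by exists (z - 1); rewrite intrB.
have H j : (0 < j < k)%N -> walk x j <= -1.
  elim: j => // -[_ _|j IH /= jk]; first by rewrite walkS walk0 x0 add0r.
  have : walk x j.+2 <= 0.
    rewrite walkS; have : walk x j.+1 <= -1 by apply: IH; lia.
    by case: (x1 j.+1) => ->; lra.
  have : walk x j.+2 <> 0 by move=> /(kx j.+2 isT); lia.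
  have [z ->] := walk_int j.+2.
  rewrite -[0]/(0%:~R) -[-1]/((-1)%:~R) !ler_int => z0 zle.
  have : z <> 0 by move=> z00; apply: z0; rewrite z00.
  lia.
case: k kx H => [|[|k]] kx H; rewrite ?walk0// walkS.
  by rewrite walk0 x0; lra.
have := H k.+1; rewrite /= ltnSn => /(_ isT).
by case: (x1 k.+1) => ->; lra.
Qed.

(** The two verdicts concern the whole infinite path, even one that never returns to 0, because the
    steps read so far already force them. The [Inside] clause is the invariant that makes this
    provable. *)
Lemma scanP x n i : (forall j, x j = 1 \/ x j = -1) -> (0 < i)%N ->
  match scan i (word_of_steps x n) with
  | Start => n = 0%N
  | Inside l b => [/\ (0 < n)%N, walk x n = l%:R,
      (forall j, (0 < j <= n)%N -> 0 < walk x j <= i%:R) &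
      if b then exists2 j, (0 < j <= n)%N & walk x j = i%:R
      else forall j, (0 < j <= n)%N -> walk x j <= i%:R - 1]
  | Success => max_until_return x = i%:R%:E
  | Failure => max_until_return x <> i%:R%:E
  end.
Proof.
move=> x1 i0; elim: n => // n IH.
rewrite word_of_stepsS scan_rcons.
have xn : x n = if x n == 1 then 1 else -1.
  by case: (x1 n) => ->; rewrite ?eqxx// ifF//; apply/eqP => h; lra.
case E: (scan i _) IH => [|l b||] //=.
  move=> n0; rewrite n0 in xn *; case: ifP xn => [_|_] x0.
    have w1 : walk x 1 = 1 by rewrite walkS walk0 add0r.
    split => //.
      move=> j j1; have -> : j = 1%N by lia.
      by rewrite w1 ltr01 ler1n.
    case: eqP => [i1|i1].
      by exists 1%N; rewrite // w1 -i1.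
    move=> j j1; have -> : j = 1%N by lia.
    have : 2 <= i%:R :> R by rewrite (ler_nat _ 2); lia.
    by rewrite w1; lra.
  have : (max_until_return x <= 0)%E.
    by apply: max_until_return_le => k; exact: walk_negative_excursion.
  by move=> h e; move: h; rewrite e lee_fin lern0; lia.
have [l0 li bi] := scan_inside i0 E.
move=> [n0 wn wj bj].
have wj0 j : (0 < j)%N -> walk x j = 0 -> (n < j)%N.
  move=> j0 xj; rewrite ltnNge; apply/negP => jn.
  by have := wj j; rewrite j0 jn xj ltxx => /(_ isT).
case: ifP xn => [_|_] xn.
  have wn1 : walk x n.+1 = l.+1%:R by rewrite walkS wn xn -natr1.
  case: ltnP => l'i.
    split => //.
      move=> j; case: (ltnP n j) => [nj /andP[_ jn]|jn /andP[j0 _]].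
        have -> : j = n.+1 by lia.
        by rewrite wn1 ltr0n ler_nat.
      by apply: wj; rewrite j0.
    case: eqP => [l1i|l1i].
      by rewrite orbT; exists n.+1; rewrite ?leqnn// wn1 l1i.
    rewrite orbF; case: (b) bj => [[j jn xj]|bj].
      by exists j => //; lia.
    move=> j; case: (ltnP n j) => [nj /andP[_ jn]|jn /andP[j0 _]].
      have -> : j = n.+1 by lia.
      have : l.+2%:R <= i%:R :> R by rewrite ler_nat; lia.
      by rewrite wn1 -[l.+2%:R]natr1; lra.
    by apply: bj; rewrite j0.
  have : ((walk x n.+1)%:E <= max_until_return x)%E.
    by apply: max_until_return_ge => j; exact: wj0.
  by rewrite wn1 => h e; move: h; rewrite e lee_fin ler_nat; lia.
case: l l0 li bi wn E => [//|[|l]] _ li bi wn E.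
  have wn1 : walk x n.+1 = 0 by rewrite walkS wn xn subrr.
  have kn k : (forall j, (0 < j)%N -> walk x j = 0 -> (k <= j)%N) -> (k <= n.+1)%N.
    by apply.
  case: b bj bi E => [[j jn xj]|bj] bi E.
    apply/eqP; rewrite eq_le; apply/andP; split.
      apply: max_until_return_le => k /kn; rewrite leq_eqVlt => /orP[/eqP ->|kn'].
        by rewrite wn1.
      case: k kn' => [|k] kn'; first by rewrite walk0.
      by have /andP[] := wj k.+1 kn'.
    rewrite -xj; apply: max_until_return_ge => k k0 /(wj0 _ k0); lia.
  have : (max_until_return x <= (i%:R - 1)%:E)%E.
    have i1 : 1 <= i%:R :> R by rewrite ler1n.
    apply: max_until_return_le => k /kn; rewrite leq_eqVlt => /orP[/eqP ->|kn'].
      by rewrite wn1; lra.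
    case: k kn' => [|k] kn'; first by rewrite walk0; lra.
    exact: bj.
  by move=> h e; move: h; rewrite e lee_fin; lra.
have wn1 : walk x n.+1 = l.+1%:R by rewrite walkS wn xn -[l.+2%:R]natr1; ring.
split => //.
  move=> j; case: (ltnP n j) => [nj /andP[_ jn]|jn /andP[j0 _]].
    have -> : j = n.+1 by lia.
    by rewrite wn1 ltr0n ler_nat; lia.
  by apply: wj; rewrite j0.
case: (b) bj => [[j jn xj]|bj].
  by exists j => //; lia.
move=> j; case: (ltnP n j) => [nj /andP[_ jn]|jn /andP[j0 _]].
  have -> : j = n.+1 by lia.
  have : l.+2%:R <= i%:R :> R by rewrite ler_nat; lia.
  by rewrite wn1 -[l.+2%:R]natr1; lra.
by apply: bj; rewrite j0.
Qed.

End first_excursion.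

(** * Gambler's ruin for the scan *)

Section scan_mean.
Context (R : realType) (p : R).
Hypotheses (p_gt0 : 0 < p) (p_lt1 : p < 1).
Context (m : nat).
Let i := m.+1.
Let r := (1 - p) / p.

(** Shifted by one from [geom_sum], so that [geo 0 = 0] is the boundary value at level 0. *)
Let geo l := \sum_(k < l) r ^+ k.

Let geoS l : geo l.+1 = geo l + r ^+ l.
Proof. by rewrite /geo big_ord_recr. Qed.

Let geo0 : geo 0 = 0. Proof. by rewrite /geo big_ord0. Qed.

Let r_ge0 : 0 <= r. Proof. by rewrite divr_ge0 ?subr_ge0 ?ltW. Qed.

Let geoSl l : geo l.+1 = 1 + r * geo l.
Proof.
rewrite /geo big_ord_recl expr0 mulr_sumr; congr (_ + _).
by apply: eq_bigr => j _; rewrite exprS.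
Qed.

Let geo_gt0 l : (0 < l)%N -> 0 < geo l.
Proof. by case: l => // l _; exact: geom_sum_gt0. Qed.

Let geo_harmonic l : p * geo l.+2 + (1 - p) * geo l = geo l.+1.
Proof.
have rE : 1 - p = r * p by rewrite divfK// gt_eqF.
have pr : p + r * p = 1 by rewrite -rE addrC subrK.
rewrite rE (geoSl l.+1) -[RHS]mul1r -[X in _ = X * _]pr geoSl; ring.
Qed.

(** The probability of reaching 0 before level [i.+1] when starting from level [i]. *)
Let top := 1 - geo i / geo i.+1.

(* The probability that the scan eventually succeeds. *)
Let success_prob s : R := match s with
  | Start => p * (geo 1 / geo i * top)
  | Inside l b => if b then 1 - geo l / geo i.+1 else geo l / geo i * top
  | Success => 1
  | Failure => 0
  end.

Let success_prob_harmonic u :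
  p * success_prob (scan i (rcons u true)) +
  (1 - p) * success_prob (scan i (rcons u false)) = success_prob (scan i u).
Proof.
rewrite !scan_rcons.
have gi0 : geo i != 0 by rewrite gt_eqF// geo_gt0.
have gi10 : geo i.+1 != 0 by rewrite gt_eqF// geo_gt0.
have topE : geo i / geo i * top = 1 - geo i / geo i.+1 by rewrite divff// mul1r.
case E: (scan i u) => [|l b||] /=; [|  |by ring|by ring].
  rewrite mulr0 addr0; by case: eqP => //= ->; rewrite topE.
have [l0 li bi] := scan_inside (isT : (0 < i)%N) E.
have -> : success_prob (if (l < i)%N then Inside l.+1 (b || (l.+1 == i)) else
  Failure)
   = if b then 1 - geo l.+1 / geo i.+1 else geo l.+1 / geo i * top.
  case: ltnP => li' /=.
    case: eqP => [->|_]; last by rewrite orbF.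
    by rewrite orbT topE; case: (b).
  have -> : l = i by lia.
  case: b bi {E} => bi; first by rewrite divff// subrr.
  by have := bi isT; lia.
case: l l0 {li bi E} => // l _.
have -> : success_prob (match l with
    | 0 => if b then Success else Failure | l'.+1 => Inside l'.+1 b end) =
    if b then 1 - geo l / geo i.+1 else geo l / geo i * top.
  by case: l => //=; case: (b); rewrite geo0 ?mul0r ?subr0.
rewrite -(geo_harmonic l); case: (b) => /=; ring.
Qed.

Let success_prob_itv u : 0 <= success_prob (scan i u) <= 1.
Proof.
have le1 a b : (a <= b)%N -> (0 < b)%N -> 0 <= geo a / geo b <= 1.
  move=> ab b0; have ga : 0 <= geo a by case: (a) => [|a'];
    rewrite ?geo0// ltW// geo_gt0.
  rewrite divr_ge0//= ?ler_pdivrMr ?geo_gt0 ?mul1r// ?(ltW (geo_gt0 b0))//.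
  rewrite -(subnKC ab) /geo big_split_ord /= lerDl.
  by apply: sumr_ge0 => k _; rewrite exprn_ge0.
have /andP[t0 t1] : 0 <= top <= 1.
  by have := le1 i i.+1 (leqnSn _) isT; rewrite /top; lra.
have bnd l : (l <= i)%N -> 0 <= geo l / geo i * top <= 1.
  move=> li; have /andP[h0 h1] := le1 l i li isT.
  by rewrite mulr_ge0//= mulr_ile1.
case E: (scan i u) => [|l b||] /=; rewrite ?lexx ?ler01//.
  have /andP[h0 h1] := bnd 1%N isT.
  apply/andP; split; first exact: mulr_ge0 (ltW p_gt0) h0.
  exact: mulr_ile1 (ltW p_gt0) h0 (ltW p_lt1) h1.
have [l0 li _] := scan_inside (isT : (0 < i)%N) E.
case: b {E}; last exact: bnd.
by have := le1 l i.+1 (leqW li) isT; lra.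
Qed.

(** Since [p * B = 2], the upward step alone makes the mean of [A - B ^+ l] drop by at least
    [B ^+ l >= 1], wherever a downward step leads. [A] bounds the potential, so this is a decrease
    by the factor [1 - A^-1]; the 2 in [A] keeps the potential at least 1 on live states. *)
Let B : R := 2 / p.
Let A : R := 2 * B ^+ i.+1.

(* A function of the state which decreases on average by at least 1. *)
Let potential s : R := match s with
  | Start => A - 1
  | Inside l _ => A - B ^+ l
  | _ => 0
  end.

Let B_ge2 : 2 <= B.
Proof. by rewrite ler_pdivlMr// mulrC ger_pMl// ltW. Qed.

Let BX_ge1 l : 1 <= B ^+ l.
Proof. by rewrite exprn_ege1//; have := B_ge2; lra. Qed.

Let BX_le l : (l <= i.+1)%N -> B ^+ l <= B ^+ i.+1.
Proof. by move=> li; rewrite ler_weXn2l//; have := B_ge2; lra. Qed.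

Let live_le_potential u : (scan_live (scan i u))%:R <= potential (scan i u).
Proof.
case E: (scan i u) => [|l b||] //=.
  have := BX_ge1 i.+1; rewrite /A; lra.
have [_ li _] := scan_inside (isT : (0 < i)%N) E.
have := BX_le (leqW li); have := BX_ge1 i.+1; rewrite /A; lra.
Qed.

Let A_ge1 : 1 <= A.
Proof. by have := BX_ge1 i.+1; rewrite /A; lra. Qed.

Let potential_decrease u :
  p * potential (scan i (rcons u true)) +
  (1 - p) * potential (scan i (rcons u false)) <= (1 - A^-1) * potential (scan i u).
Proof.
have A0 : 0 < A := lt_le_trans ltr01 A_ge1.
have pB : p * B = 2 by rewrite mulrC divfK// gt_eqF.
have p1 : 0 <= 1 - p by rewrite subr_ge0 ltW.
have key l s0 s1 : (l <= i)%N -> s1 <= A - B ^+ l.+1 -> s0 <= A ->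
    p * s1 + (1 - p) * s0 <= (1 - A^-1) * (A - B ^+ l).
  move=> li h1 h0.
  apply: le_trans (lerD (ler_wpM2l (ltW p_gt0) h1) (ler_wpM2l p1 h0)) _.
  have -> : p * (A - B ^+ l.+1) + (1 - p) * A = A - 2 * B ^+ l.
    by rewrite exprS -pB; ring.
  have -> : (1 - A^-1) * (A - B ^+ l) = A - B ^+ l - 1 + A^-1 * B ^+ l.
    by field; rewrite gt_eqF.
  have : 0 <= A^-1 * B ^+ l by rewrite mulr_ge0 ?invr_ge0 ?ltW// (lt_le_trans
    ltr01).
  have := BX_ge1 l; lra.
have potA s : potential s <= A.
  have := A_ge1; case: s => [|l b||] /=; try lra.
  by have := BX_ge1 l; lra.
rewrite !scan_rcons; case E: (scan i u) => [|l b||]; last 2 first.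
- by rewrite /= !mulr0 addr0.
- by rewrite /= !mulr0 addr0.
- by have := @key 0%N (potential (scan_step i Start false))
    (potential (scan_step i Start true)); rewrite expr0; apply.
have [_ li _] := scan_inside (isT : (0 < i)%N) E.
apply: (key l) => //=; case: ltnP => //= _.
by have := @BX_le l.+1 li; have := BX_ge1 i.+1; rewrite /A; lra.
Qed.

Let p01 : 0 <= p <= 1. Proof. by rewrite !ltW. Qed.

(** A live scan is confined to the strip up to level [i], which the walk leaves exponentially fast
    for every p, even when it may never return to 0. *)
Lemma cvg_mean_scan_live :
  mean p n (fun u => (scan_live (scan i u))%:R) @[n --> \oo] --> (0 : R).
Proof.
have A0 : 0 < A := lt_le_trans ltr01 A_ge1.
have q0 : 0 <= 1 - A^-1 by rewrite subr_ge0 invf_le1.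
have bound n : mean p n (fun u => potential (scan i u)) <= (1 - A^-1) ^+ n * A.
  elim: n => [|n IH] /=; first by rewrite mul1r; lra.
  rewrite exprS -mulrA; apply: le_trans (ler_wpM2l q0 IH).
  by rewrite -meanZ; apply: ler_mean => // u _; exact: potential_decrease.
apply: (@squeeze_cvgr _ _ _ _ (fun=> 0) (fun n => (1 - A^-1) ^+ n * A)).
- apply: nearW => n; apply/andP; split.
    by rewrite -(mean_cst p n 0); apply: ler_mean.
  apply: le_trans (bound n); apply: ler_mean => // u _; exact: live_le_potential.
- exact: cvg_cst.
- rewrite -[X in _ --> X](mul0r A); apply: cvgM; last exact: cvg_cst.
  apply: cvg_expr.
  by rewrite ger0_norm// ltrBlDr ltrDl invr_gt0.
Qed.

(** By harmonicity the density is the mean of [success_prob] at every time, and [success_prob]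
    differs from the indicator of success only on live states. *)
Lemma mean_scan_success n :
  mean p n (fun u => (scan_success (scan i u))%:R) <=
  soliton_density p m <=
  mean p n (fun u => (scan_success (scan i u))%:R) +
  mean p n (fun u => (scan_live (scan i u))%:R).
Proof.
have fE : soliton_density p m = mean p n (fun u => success_prob (scan i u)).
  elim: n => [|n ->] /=.
    have g1 : geo 1 = 1 by rewrite geoS geo0 expr0 add0r.
    rewrite /soliton_density -/r /geom_sum -/(geo i) -/(geo i.+1) /top g1.
    have gi0 : geo i != 0 by rewrite gt_eqF// geo_gt0.
    have gi10 : geo i.+1 != 0 by rewrite gt_eqF// geo_gt0.
    have -> : r ^+ m.+1 = geo i.+1 - geo i by rewrite geoS; ring.
    by rewrite /i in gi0 gi10 *; field; rewrite ?gi0 ?gi10.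
  by apply: eq_mean => u _; rewrite success_prob_harmonic.
rewrite fE -meanD; apply/andP; split; apply: ler_mean => // u _.
  by have := success_prob_itv u; case: (scan i u) => [|l b||] /= /andP[].
by have := success_prob_itv u; case: (scan i u) => [|l b||] /= /andP[];
  rewrite ?addr0 ?add0r.
Qed.

End scan_mean.

(** * The law of the height of the first excursion *)

Section max_until_return_law.
Context d (T : measurableType d) (R : realType) (P : probability T R).
Context (X : nat -> {RV P >-> R}).

Lemma measurable_walk k : measurable_fun setT (fun w => walk (fun k => X k w) k).
Proof. by apply: measurable_sum => j; exact: measurable_funP. Qed.

Lemma measurable_max_until_return (c : \bar R) :
  measurable [set w | max_until_return (fun k => X k w) = c].
Proof.
pose ok k w := forall j, (0 < j)%N -> walk (fun k => X k w) j = 0 -> (k <= j)%N.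
(* After the return the walk is replaced by 0, a value already taken at time 0: the supremum is
   unchanged and becomes one of a sequence of measurable functions. *)
pose g k w := if `[< ok k w >] then (walk (fun k => X k w) k)%:E else 0%E.
have -> : [set w | max_until_return (fun k => X k w) = c] =
    setT `&` (fun w => esups (g ^~ w) 0%N) @^-1` [set c].
  rewrite setTI; apply/seteqP; split => w /= <-; apply/eqP; rewrite eq_le;
    apply/andP; split.
  - apply: ge_ereal_sup => _ [k _ <-]; rewrite /g; case: asboolP => kx.
      exact: max_until_return_ge.
    by have := @max_until_return_ge _ (fun k => X k w) 0; rewrite walk0; apply.
  - apply: ge_ereal_sup => _ [k /le_return_time kx <-].
    by apply: ereal_sup_ubound; exists k => //; rewrite /g; case: asboolP.
  - apply: ge_ereal_sup => _ [k /le_return_time kx <-].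
    by apply: ereal_sup_ubound; exists k => //; rewrite /g; case: asboolP.
  - apply: ge_ereal_sup => _ [k _ <-]; rewrite /g; case: asboolP => kx.
      exact: max_until_return_ge.
    by have := @max_until_return_ge _ (fun k => X k w) 0; rewrite walk0; apply.
suff : measurable_fun setT ((fun w => esups (g ^~ w) 0%N) : T -> \bar R).
  by apply; [exact: measurableT|exact: emeasurable_set1].
apply: measurable_fun_esups => k; apply: measurable_fun_ifT.
- apply: (measurable_fun_bool true); rewrite setTI.
  have -> : (fun w => `[< ok k w >]) @^-1` [set true] =
      \bigcap_(j in [set j | (0 < j < k)%N]) ~` [set w | walk (fun k => X k w) j =
        0].
    apply/seteqP; split => w /=.
      by move=> /asboolP kx j /= /andP[j0 jk] xj; have := kx j j0 xj; lia.
    move=> kx; apply/asboolP => j j0 xj; rewrite leqNgt; apply/negP => jk.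
    by apply: (kx j) => //=; rewrite j0.
  apply: bigcap_measurableType => j _.
  apply: measurableC; rewrite -[X in measurable X]setTI.
  exact: (measurable_walk j measurableT (measurable_set1 0)).
- by apply/measurable_EFinP; exact: measurable_walk.
- exact: measurable_cst.
Qed.

(** Up to a null set the event lies between success of the scan by time n and success or life at
    time n; both probabilities tend to the density. *)
Lemma prob_max_until_return (p : R) m : 0 < p -> p < 1 -> iid X ->
  P [set w | X 0%N w = 1] = p%:E -> P [set w | X 0%N w = -1] = (1 - p)%:E ->
  P [set w | max_until_return (fun k => X k w) = m.+1%:R%:E] =
  (soliton_density p m)%:E.
Proof.
move=> p0 p1 X_iid X_up X_down.
set E := [set w | max_until_return _ = _].
have mE : measurable E by exact: measurable_max_until_return.
have mX k (a : R) : measurable [set w | X k w = a].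
  rewrite -[X in measurable X]setTI.
  exact: (measurable_funP (X k)) measurableT _ (measurable_set1 a).
(* The steps equal 1 or -1 only almost surely, and [scanP] applies off [N]. *)
pose N := \bigcup_k ~` ([set w | X k w = 1] `|` [set w | X k w = -1]).
have mN : measurable N.
  by apply: bigcup_measurable => k _; apply: measurableC; exact: measurableU.
have PC k : P (~` ([set w | X k w = 1] `|` [set w | X k w = -1])) = 0%E.
  rewrite probability_setC; last exact: measurableU.
  have -> : P ([set w | X k w = 1] `|` [set w | X k w = -1]) =
    (P [set w | X k w = 1%R] + P [set w | X k w = (-1)%R])%E.
    apply: measureU => //; apply/seteqP; split => w //= [-> h].
    by have : (1 : R) <> -1 by move=> ?; lra.
  have same a : P [set w | X k w = a] = P [set w | X 0%N w = a].
    have /(_ k [set a]) := X_iid.2.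
    by rewrite /distribution /pushforward; apply; exact: measurable_set1.
  have e1 : p + (1 - p) = 1 by ring.
  by rewrite !same X_up X_down -EFinD e1 subrr.
have N0 : P N = 0%E.
  apply/negligibleP; [exact: mN|apply: negligible_bigcup => k].
  by apply/negligibleP; [apply: measurableC; exact: measurableU|exact: PC].
have X1 w : ~ N w -> forall k, X k w = 1 \/ X k w = -1.
  move=> Nw k; apply: contrapT => h; apply: Nw; exists k => //.
set word := fun n w => word_of_steps (fun k => X k w) n.
pose W n := [set w | scan_success (scan m.+1 (word n w))].
pose L n := [set w | scan_success (scan m.+1 (word n w)) || scan_live (scan m.+1
  (word n w))].
have mW n : measurable (W n) := measurable_word X n (fun u =>
  scan_success (scan m.+1 u)).
have mL n : measurable (L n) :=
  measurable_word X n (fun u =>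
    scan_success (scan m.+1 u) || scan_live (scan m.+1 u)).
have PN A B : measurable A -> measurable B -> A `<=` B `|` N -> (P A <= P B)%E.
  move=> mA mB AB; rewrite -(measureU0 mB mN N0); apply: le_measure => //;
    rewrite inE//.
  exact: measurableU.
have WE n : (P (W n) <= P E)%E.
  apply: PN => // w /= Ww; have [?|Nw] := pselect (N w); [by right|left].
  have := @scanP _ (fun k => X k w) n m.+1 (X1 w Nw) isT.
  by rewrite -/(word n w); move: Ww; rewrite /W /=; case: (scan _ _).
have EL n : (P E <= P (L n))%E.
  apply: PN => // w /= Ew; have [?|Nw] := pselect (N w); [by right|left].
  have := @scanP _ (fun k => X k w) n m.+1 (X1 w Nw) isT.
  by rewrite /L /= -/(word n w); case: (scan _ _).
have PEfin : P E = (fine (P E))%:E by rewrite fineK// fin_num_measure.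
rewrite PEfin; congr EFin.
pose a n := mean p n (fun u => (scan_success (scan m.+1 u))%:R).
pose b n := mean p n (fun u => (scan_live (scan m.+1 u))%:R).
have aE n : a n <= fine (P E).
  rewrite -lee_fin -PEfin -(prob_word X_iid X_up n (fun u =>
    scan_success (scan m.+1 u))).
  exact: WE.
have Eab n : fine (P E) <= a n + b n.
  rewrite -lee_fin -PEfin; apply: le_trans (EL n) _.
  rewrite /L (prob_word X_iid X_up n (fun u =>
    scan_success (scan m.+1 u) || scan_live (scan m.+1 u))).
  rewrite lee_fin /a /b -meanD; apply: ler_mean => [|u _]; first by rewrite !ltW.
  by case: (scan _ _) => [|l c||] /=; rewrite ?addr0 ?add0r.
have ad n : a n <= soliton_density p m <=
  a n + b n by exact: (mean_scan_success p0 p1 m n).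
have dist n : `|fine (P E) - soliton_density p m| <= b n.
  have := aE n; have := Eab n; have /andP[] := ad n; rewrite ler_norml; lra.
apply/eqP; rewrite -subr_eq0 -normr_eq0 eq_le normr_ge0 andbT.
have b0 : b n @[n --> \oo] --> (0 : R) by exact: cvg_mean_scan_live.
have -> : 0 = limn b by apply/esym/cvg_lim.
apply: limr_ge; first by apply/cvg_ex; exists 0.
exact: nearW.
Qed.

End max_until_return_law.

(** * Central limit theorem *)

Section gaussian.
Context {R : realType}.
Implicit Types (x z h t : R).

(** Iterated, this yields Taylor remainders one derivative at a time; the factor [k.+1^-1] is given
    up since only the order matters. *)
Lemma mvt_pow_bound (f df : R -> R) (c : R) k x :
  (forall t, is_derive t 1 f (df t)) -> f 0 = 0 ->
  (forall t, 0 <= t <= x \/ x <= t <= 0 -> `|df t| <= c * `|t| ^+ k) ->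
  `|f x| <= c * `|x| ^+ k.+1.
Proof.
move=> fdf f0 dfc.
have fcont : continuous f.
  move=> t; apply: differentiable_continuous; apply/derivable1_diffP.
  by have [] := fdf t.
have c0 : 0 <= c * `|x| ^+ k.
  by apply: le_trans (normr_ge0 (df x)) (dfc _ _); case: (leP 0 x) => h;
    [left|right]; rewrite ?h lexx ?(ltW h).
have mvt t : 0 <= t <= x \/ x <= t <= 0 -> `|df t| <= c * `|x| ^+ k.
  move=> tx; apply: le_trans (dfc t tx) _.
  have tx' : `|t| <= `|x|.
    case: tx => /andP[t0 tx].
      by rewrite !ger0_norm// (le_trans t0).
    by rewrite !ler0_norm// ?lerN2// (le_trans t0).
  have [c_lt0|c_ge0] := ltP c 0.
    have x0 : `|x| ^+ k = 0.
      apply/eqP; rewrite eq_le exprn_ge0// andbT.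
      by rewrite -(ler_nM2l c_lt0) mulr0.
    by rewrite x0 mulr0 nmulr_rle0// exprn_ge0.
  by rewrite ler_wpM2l// lerXn2r ?nnegrE.
rewrite exprSr mulrA.
have [x0|x0] := leP 0 x.
  have [t] := @MVT_segment R f df 0 x x0 (fun t _ =>
    fdf t) (continuous_subspaceT fcont).
  rewrite in_itv /= f0 !subr0 => tx ->; rewrite normrM ler_wpM2r//.
  by apply: mvt; left.
have [t] := @MVT_segment R f df x 0 (ltW x0) (fun t _ =>
  fdf t) (continuous_subspaceT fcont).
rewrite in_itv /= f0 sub0r => tx /(congr1 Num.norm).
rewrite normrN sub0r normrM normrN => ->; rewrite ler_wpM2r//.
by apply: mvt; right.
Qed.

Definition gauss_pdf x : R := normal_pdf 0 1 x.
Definition gauss_cdf x : R := fine (normal_prob (0 : R) 1 `]-oo, x]%classic).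

Lemma gauss_pdfE x : gauss_pdf x = normal_peak 1 * expR (- (x ^+ 2 / 2)).
Proof.
by rewrite /gauss_pdf normal_pdfE ?oner_neq0// /normal_fun subr0 expr1n mulNr.
Qed.

Lemma gauss_pdf_ge0 x : 0 <= gauss_pdf x.
Proof. exact: normal_pdf_ge0. Qed.

Lemma is_derive_gauss_cdf x : is_derive x 1 gauss_cdf (gauss_pdf x).
Proof.
have [||||h1 h2] := @continuous_FTC1 R gauss_pdf -oo%O x (x + 1).
- by rewrite ltrDl.
- apply: integrableS (integrable_normal_pdf 0 1) => //.
- by rewrite ltNyr.
- exact: continuous_normal_pdf (oner_neq0 _) x.
by split; [exact: h1|rewrite -derive1E].
Qed.

Lemma is_derive_gauss_pdf x : is_derive x 1 gauss_pdf (- (x * gauss_pdf x)).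
Proof.
rewrite (_ : gauss_pdf = fun x => normal_peak 1 * expR (- (x ^+ 2 / 2)));
  last first.
  by apply/funext => t; exact: gauss_pdfE.
apply: is_derive_eq.
by by rewrite /GRing.scale /=; field.
Qed.

Lemma gauss_pdf_decay : exists2 C : R, 0 < C &
  forall z, gauss_pdf z * (1 + `|z|) ^+ 3 <= C.
Proof.
set K := normal_peak (1 : R).
have K0 : 0 < K by rewrite normal_peak_gt0 ?oner_neq0.
(* (1 + a)^3 <= 8 + 7 a^4 <= 64 (1 + a^4 / 8), and the last bracket is at most exp(a^2 / 2). *)
exists (64 * K); first by rewrite mulr_gt0.
move=> z; set a := `|z|; have a0 : 0 <= a by exact: normr_ge0.
have -> : gauss_pdf z = K * expR (- (a ^+ 2 / 2)).
  by rewrite gauss_pdfE /a real_normK ?num_real.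
set y := a ^+ 2 / 2; have y0 : 0 <= y by rewrite divr_ge0// sqr_ge0.
have e4 : 1 + a ^+ 4 / 8 <= expR y.
  apply: le_trans (@expR_ge1Dxn R y 1 y0).
  have -> : y ^+ 2 / 2`!%:R = a ^+ 4 / 8 by rewrite /y (_ : 2`! = 2)%N//; field.
  exact: lexx.
have le4 k : (k <= 4)%N -> a ^+ k <= 1 + a ^+ 4.
  move=> k4; have [a1|a1] := leP a 1.
    by apply: le_trans (exprn_ile1 _ a0 a1) _; rewrite lerDl exprn_ge0.
  by apply: le_trans (ler_weXn2l (ltW a1) k4) _; rewrite lerDr.
rewrite expRN -mulrA [64 * K]mulrC ler_pM2l// mulrC ler_pdivrMr ?expR_gt0//.
have := le4 1%N isT; have := le4 2%N isT; have := le4 3%N isT.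
have : 0 <= a ^+ 4 by rewrite exprn_ge0.
have -> : (1 + a) ^+ 3 = 1 + 3 * a ^+ 1 + 3 * a ^+ 2 + a ^+ 3 by ring.
move: (a ^+ 1) (a ^+ 2) (a ^+ 3) (a ^+ 4) (expR y) e4 {le4} => *; lra.
Qed.

(* Minus the second derivative of [gauss_cdf]. *)
Definition gauss_psi z : R := z * gauss_pdf z.

Lemma is_derive_gauss_psi z :
  is_derive z 1 gauss_psi ((1 - z ^+ 2) * gauss_pdf z).
Proof.
rewrite /gauss_psi; have := is_derive_gauss_pdf z => dg.
apply: is_derive_eq; rewrite /GRing.scale /=; ring.
Qed.

Lemma is_derive_affine (f df : R -> R) (a b x : R) :
  (forall t, is_derive t 1 f (df t)) ->
  is_derive x 1 (fun t => f (a + b * t)) (b * df (a + b * x)).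
Proof.
move=> fdf; have fx := fdf (a + b * x).
have lx : is_derive x 1 (fun t : R => a + b * t) b.
  by apply: is_derive_eq; rewrite /GRing.scale /=; ring.
by have := @is_derive1_comp R f (fun t : R => a + b * t) x _ _ fx lx; rewrite mulrC.
Qed.

(** The second and third estimates serve for a martingale increment [h], the last two for a change
    of scale from [z] to [z * (1 - h)]. There powers of [z] appear; for [h <= 2^-1] they are bounded
    by powers of the shrunk point and absorbed by the decay of the density. *)
Lemma gauss_estimates : exists2 C : R, 0 < C & [/\
  forall z, `|gauss_psi z| <= C,
  forall z h, `|gauss_psi (z + h) - gauss_psi z| <= C * `|h|,
  forall z h, `|gauss_cdf (z + h) - gauss_cdf z - h * gauss_pdf z
                + 2^-1 * h ^+ 2 * gauss_psi z| <= C * `|h| ^+ 3,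
  forall z h, 0 <= h <= 2^-1 -> `|gauss_psi (z - z * h) - gauss_psi z| <= C * h &
  forall z h, 0 <= h <= 2^-1 ->
    `|gauss_cdf (z - z * h) - gauss_cdf z + h * gauss_psi z| <= C * h ^+ 2].
Proof.
have [D D0 decay] := gauss_pdf_decay.
have dec (k : nat) z : (k <= 3)%N -> `|z| ^+ k * gauss_pdf z <= D.
  move=> k3; rewrite mulrC; apply: le_trans (decay z);
    rewrite ler_wpM2l ?gauss_pdf_ge0//.
  apply: (@le_trans _ _ ((1 + `|z|) ^+ k)).
    by rewrite lerXn2r ?nnegrE ?addr_ge0// lerDr.
  by rewrite ler_weXn2l// lerDl.
have d0 z := dec 0%N z isT; have d1 z := dec 1%N z isT.
have d2 z := dec 2%N z isT; have d3 z := dec 3%N z isT.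
have psiD z : `|gauss_psi z| <= D.
  by rewrite normrM (ger0_norm (gauss_pdf_ge0 z)); have := d1 z; rewrite expr1.
have dpsiD z : `|(1 - z ^+ 2) * gauss_pdf z| <= 2 * D.
  rewrite normrM (ger0_norm (gauss_pdf_ge0 z)).
  have : `|1 - z ^+ 2| <= 1 + `|z| ^+ 2.
    by apply: le_trans (ler_normB _ _) _; rewrite normr1 normrX.
  move=> /(ler_wpM2r (gauss_pdf_ge0 z)); have := d0 z; have := d2 z.
  by rewrite expr0; lra.
have psi_lip z h : `|gauss_psi (z + h) - gauss_psi z| <= 2 * D * `|h|.
  pose f t := gauss_psi (z + 1 * t) - gauss_psi z.
  have : `|f h| <= 2 * D * `|h| ^+ 1.
    apply: (@mvt_pow_bound f (fun t =>
      1 * ((1 - (z + 1 * t) ^+ 2) * gauss_pdf (z + 1 * t)))) => [t||t _].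
    + have := is_derive_affine z 1 t is_derive_gauss_psi => dt.
      by rewrite /f; apply: is_derive_eq; rewrite subr0.
    + by rewrite /f mul1r addr0 subrr.
    + by rewrite mul1r expr0 mulr1.
  by rewrite /f mul1r expr1.
have shrink t h : 0 <= h -> h <= 2^-1 -> 0 <= t <= h \/ h <= t <= 0 -> 0 <= t <=
  2^-1.
  by move=> h0 h1 [|] /andP[]; lra.
have zle z t : 0 <= t <= 2^-1 -> `|z| <= 2 * `|z + - z * t|.
  move=> /andP[t0 t1]; have -> : z + - z * t = z * (1 - t) by ring.
  rewrite normrM (ger0_norm (x := 1 - t)); last lra.
  by have := normr_ge0 z; nra.
exists (16 * D); first by rewrite mulr_gt0.
split.
- by move=> z; have := psiD z; lra.
- by move=> z h; apply: le_trans (psi_lip z h) _; rewrite ler_wpM2r//; lra.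
- move=> z h.
  have pdf2 t : `|- gauss_pdf (z + 1 * t) + gauss_pdf z - t * gauss_psi z| <=
    2 * D * `|t| ^+ 2.
    pose f t := - gauss_pdf (z + 1 * t) + gauss_pdf z - t * gauss_psi z.
    apply: (@mvt_pow_bound f (fun t => gauss_psi (z + t) - gauss_psi z)) =>
      [s||s _].
    + have := is_derive_affine z 1 s is_derive_gauss_pdf => ds.
      rewrite /f; apply: is_derive_eq; rewrite /GRing.scale /= /gauss_psi !mul1r;
        ring.
    + by rewrite /f mul1r addr0 mul0r subr0 addNr.
    + by rewrite expr1.
  pose f t := gauss_cdf (z + 1 * t) - gauss_cdf z - t * gauss_pdf z + 2^-1 * t ^+
    2 * gauss_psi z.
  have : `|f h| <= 2 * D * `|h| ^+ 3.
    apply: (@mvt_pow_bound f (fun t =>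
      - (- gauss_pdf (z + 1 * t) + gauss_pdf z - t * gauss_psi z))) => [s||s _].
    + have := is_derive_affine z 1 s is_derive_gauss_cdf => ds.
      rewrite /f; apply: is_derive_eq; by rewrite /GRing.scale /=; field.
    + by rewrite /f (_ : z + 1 * 0 = z); ring.
    + by rewrite normrN.
  rewrite /f mul1r => /le_trans; apply.
  by rewrite ler_wpM2r ?exprn_ge0//; lra.
- move=> z h /andP[h0 h1].
  pose f t := gauss_psi (z + - z * t) - gauss_psi z.
  have : `|f h| <= 16 * D * `|h| ^+ 1.
    apply: (@mvt_pow_bound f (fun t =>
      - z * ((1 - (z + - z * t) ^+ 2) * gauss_pdf (z + - z * t)))) => [t||t th].
    + have := is_derive_affine z (- z) t is_derive_gauss_psi => dt.
      by rewrite /f; apply: is_derive_eq; rewrite subr0.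
    + by rewrite /f mulr0 addr0 subrr.
    + have zy := zle z t (shrink t h h0 h1 th).
      rewrite expr0 mulr1; set y := z + - z * t in zy *.
      rewrite !normrM normrN (ger0_norm (gauss_pdf_ge0 y)).
      have n1 : `|1 - y ^+ 2| <= 1 + `|y| ^+ 2.
        by apply: le_trans (ler_normB _ _) _; rewrite normr1 normrX.
      have g0 := gauss_pdf_ge0 y.
      apply: (@le_trans _ _ ((2 * `|y|) * ((1 + `|y| ^+ 2) * gauss_pdf y))).
        by apply: ler_pM => //; rewrite ?mulr_ge0// ler_wpM2r.
      have := d1 y; have := d3 y; rewrite expr1.
      have -> : 2 * `|y| * ((1 + `|y| ^+ 2) * gauss_pdf y) =
        2 * (`|y| * gauss_pdf y) + 2 * (`|y| ^+ 3 * gauss_pdf y) by ring.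
      by move: (`|y| * _) (_ * gauss_pdf y) => *; lra.
  by rewrite /f mulNr expr1 (ger0_norm h0).
- move=> z h /andP[h0 h1].
  have step t : 0 <= t <= 2^-1 ->
      `|- z * gauss_pdf (z + - z * t) + gauss_psi z| <= 16 * D * `|t| ^+ 1.
    move=> /andP[t0 t1].
    pose f t := - z * gauss_pdf (z + - z * t) + gauss_psi z.
    apply: (@mvt_pow_bound f (fun t =>
      - z * (- z * - ((z + - z * t) * gauss_pdf (z + - z * t))))) => [s||s st].
    + have := is_derive_affine z (- z) s is_derive_gauss_pdf => ds.
      by rewrite /f; apply: is_derive_eq; rewrite /GRing.scale /=; ring.
    + by rewrite /f mulr0 addr0 /gauss_psi; ring.
    + have zy := zle z s (shrink s t t0 t1 st).
      rewrite expr0 mulr1; set y := z + - z * s in zy *.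
      rewrite !normrM !normrN (normrM y) (ger0_norm (gauss_pdf_ge0 y)).
      have g0 := gauss_pdf_ge0 y.
      apply: (@le_trans _ _ ((2 * `|y|) * ((2 * `|y|) * (`|y| * gauss_pdf y)))).
        by apply: ler_pM => //; rewrite ?mulr_ge0// ler_wpM2r// mulr_ge0.
      have := d3 y.
      have -> : 2 * `|y| * (2 * `|y| * (`|y| * gauss_pdf y)) =
        4 * (`|y| ^+ 3 * gauss_pdf y) by ring.
      by move: (_ * gauss_pdf y) => *; lra.
  pose f t := gauss_cdf (z + - z * t) - gauss_cdf z + t * gauss_psi z.
  have : `|f h| <= 16 * D * `|h| ^+ 2.
    apply: (@mvt_pow_bound f (fun t =>
      - z * gauss_pdf (z + - z * t) + gauss_psi z)) => [s||s st].
    + have := is_derive_affine z (- z) s is_derive_gauss_cdf => ds.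
      by rewrite /f; apply: is_derive_eq; rewrite /GRing.scale /=; ring.
    + by rewrite /f mulr0 addr0; ring.
    + by apply: step; exact: shrink st.
  by rewrite /f mulNr (ger0_norm h0).
Qed.

End gaussian.

(** * One step of Lindeberg's method *)

Section lindeberg.
Context (R : realType) (p : R).
Hypotheses (p_gt0 : 0 < p) (p_lt1 : p < 1).

Let V := p * (1 - p).

Let V_gt0 : 0 < V. Proof. by rewrite mulr_gt0// subr_gt0. Qed.

Let V_le : V <= 4^-1.
Proof. by rewrite /V; have := sqr_ge0 (p - 2^-1); lra. Qed.

Let var := V * (1 - 3 * V).

Lemma run_variance_gt0 : 0 < p * (1 - p) * (1 - 3 * (p * (1 - p))).
Proof. by rewrite -/V mulr_gt0//; have := V_le; lra. Qed.

Let var_le : var <= V.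
Proof. by rewrite ler_piMr ?(ltW V_gt0)//; have := V_gt0; lra. Qed.

(* The Gaussian smoothing of an indicator, at time to go [w ^- 2] in units of
   one step, plus a term which averages the conditional variance out. *)
Definition smoothed (z w b : R) : R :=
  gauss_cdf z - 2^-1 * (p * (1 - p)) * (b - p) ^+ 2 * w ^+ 2 * gauss_psi z.

(** [k] is the ratio of the new scale to the old one: its equation says that the old variance to go,
    [(k * w) ^- 2], is the new one, [w ^- 2], plus that of one step. Five remainders cost
    [C * w ^+ 3] each. *)
Lemma lindeberg_step : exists2 C : R, 0 < C & (forall z, `|gauss_psi z| <= C) /\
  forall z w b k : R, 0 < w <= 1 -> `|b - p| <= 1 -> 0 < k ->
    k ^+ 2 * (1 + p * (1 - p) * (1 - 3 * (p * (1 - p))) * w ^+ 2) = 1 ->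
  `|p * smoothed (z - (1 - p) * (b - p) * w) w 0 +
    (1 - p) * smoothed (z + p * (b - p) * w) w 1 - smoothed (k * z) (k * w) b|
  <= 5 * C * w ^+ 3.
Proof.
have [C C0 [psiC psi_lip cdf3 psi_shrink cdf_shrink]] := @gauss_estimates R.
exists C => //; split=> // z w b k /andP[w0 w1] bp k0.
rewrite -/V -/var => kE.
pose t := var * w ^+ 2.
have var0 : 0 < var := run_variance_gt0.
have t0 : 0 <= t by rewrite mulr_ge0 ?sqr_ge0// ltW.
have w21 : w ^+ 2 <= 1 by rewrite exprn_ile1// ltW.
have tw : t <= w ^+ 2 by rewrite ler_piMl ?sqr_ge0//; have := var_le; have := V_le;
  lra.
have t4 : t <= 4^-1.
  by have : t <= var by [rewrite /t ler_piMr// ltW]; have := var_le; have := V_le;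
    lra.
have {}kE : k ^+ 2 * (1 + t) = 1 by [].
have k2 : k ^+ 2 <= 1.
  have : 0 <= k ^+ 2 * t by rewrite mulr_ge0// sqr_ge0.
  by move: kE; rewrite mulrDr mulr1; lra.
have k1 : k <= 1 by rewrite -(@expr_le1 _ 2)// ltW.
(* [e] is t / 2 up to second order: the change of scale supplies the drift that cancels the averaged
   variance. *)
pose e := 1 - k.
have e0 : 0 <= e by rewrite subr_ge0.
have et : e <= t.
  have : e <= e * (2 - e) by rewrite ler_peMr//; rewrite /e; lra.
  have -> : e * (2 - e) = t * k ^+ 2 by rewrite /e; lra.
  by move=> /le_trans; apply; rewrite ler_piMr.
have eE : 2 * e = t - t * (1 - k ^+ 2) + e ^+ 2 by rewrite /e; lra.
have e2 : 0 <= e <= 2^-1 by rewrite e0 /=; lra.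
pose d := b - p.
have d1 : `|d| <= 1 by [].
have d2 : d ^+ 2 <= 1 by rewrite -[leLHS]real_normK ?num_real// exprn_ile1.
pose h1 := - ((1 - p) * d * w); pose h0 := p * d * w.
have q0 : 0 <= 1 - p by rewrite subr_ge0 ltW.
have h1w : `|h1| <= w.
  rewrite normrN !normrM (gtr0_norm w0) (ger0_norm q0).
  by rewrite ler_piMl ?(ltW w0)// mulr_ile1// lerBlDr lerDl ltW.
have h0w : `|h0| <= w.
  rewrite !normrM (gtr0_norm w0) (gtr0_norm p_gt0).
  by rewrite ler_piMl ?(ltW w0)// mulr_ile1// ?(ltW p_gt0) ?(ltW p_lt1).
have H13 : C * `|h1| ^+ 3 <= C * w ^+ 3.
  by rewrite ler_pM2l// lerXn2r ?nnegrE// ltW.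
have H03 : C * `|h0| ^+ 3 <= C * w ^+ 3.
  by rewrite ler_pM2l// lerXn2r ?nnegrE// ltW.
have A1 := le_trans (cdf3 z h1) H13; have A0 := le_trans (cdf3 z h0) H03.
have B1 := le_trans (psi_lip z h1) (ler_wpM2l (ltW C0) h1w).
have B0 := le_trans (psi_lip z h0) (ler_wpM2l (ltW C0) h0w).
have Sp := psi_shrink z e e2; have Sc := cdf_shrink z e e2.
have Pz := psiC z.
rewrite /smoothed -/V.
have -> : z - (1 - p) * (b - p) * w = z + h1 by [].
have -> : z + p * (b - p) * w = z + h0 by [].
have -> : k * z = z - z * e by rewrite /e; ring.
rewrite exprMn -/d.
move: (gauss_cdf (z + h1)) (gauss_cdf (z + h0)) (gauss_cdf (z - z * e))
  (gauss_cdf z) (gauss_pdf z) (gauss_psi (z + h1)) (gauss_psi (z + h0))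
  (gauss_psi (z - z * e)) (gauss_psi z) A1 A0 B1 B0 Sp Sc Pz
  => F1 F0 Fk Fz fz P1 P0 Pk Pz A1 A0 B1 B0 Sp Sc bPz.
set a1 := F1 - _ - _ + _ in A1; set a0 := F0 - _ - _ + _ in A0.
set sc := Fk - _ + _ in Sc.
set b1 := P1 - Pz in B1; set b0 := P0 - Pz in B0; set sp := Pk - Pz in Sp.
have F1E : F1 = a1 + Fz + h1 * fz - 2^-1 * h1 ^+ 2 * Pz by rewrite /a1; ring.
have F0E : F0 = a0 + Fz + h0 * fz - 2^-1 * h0 ^+ 2 * Pz by rewrite /a0; ring.
have FkE : Fk = sc + Fz - e * Pz by rewrite /sc; ring.
have P1E : P1 = b1 + Pz by rewrite /b1; ring.
have P0E : P0 = b0 + Pz by rewrite /b0; ring.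
have PkE : Pk = sp + Pz by rewrite /sp; ring.
(* The terms in [fz] cancel as [p * h1 + (1 - p) * h0 = 0]. The conditional variance
   [V * d ^+ 2 * w ^+ 2] cancels against the old correction up to the factor [1 - k ^+ 2], and the
   new corrections average to p^3 + (1 - p)^3 = 1 - 3V, which leaves t / 2. *)
have mainE : p * (F1 - 2^-1 * V * (0 - p) ^+ 2 * w ^+ 2 * P1) +
   (1 - p) * (F0 - 2^-1 * V * (1 - p) ^+ 2 * w ^+ 2 * P0) -
   (Fk - 2^-1 * V * d ^+ 2 * (k ^+ 2 * w ^+ 2) * Pk) =
   (p * a1 + (1 - p) * a0) - (2^-1 * V * w ^+ 2 * (p ^+ 3 * b1 + (1 - p) ^+ 3 * b0))
   - sc + 2^-1 * V * d ^+ 2 * (k ^+ 2 * w ^+ 2) * sp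
   + (e - 2^-1 * t - 2^-1 * V * d ^+ 2 * w ^+ 2 * (1 - k ^+ 2)) * Pz.
  by rewrite F1E F0E FkE P1E P0E PkE /t /var /h1 /h0 /V; field.
rewrite mainE.
have w30 : 0 <= w ^+ 3 by rewrite exprn_ge0// ltW.
have w43 : w ^+ 4 <= w ^+ 3 by rewrite exprSr ler_piMr// ltW.
have w2_ge0 : 0 <= w ^+ 2 by rewrite sqr_ge0.
have tw4 : t <= 4^-1 * w ^+ 2.
  by rewrite ler_wpM2r//; apply: le_trans var_le V_le.
have wwE : w ^+ 2 * w ^+ 2 = w ^+ 4 by ring.
have e2w : e ^+ 2 <= 16^-1 * w ^+ 4.
  rewrite -wwE; have -> : 16^-1 * (w ^+ 2 * w ^+ 2) = (4^-1 * w ^+ 2) ^+ 2.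
    by field.
  rewrite lerXn2r ?nnegrE//; first by rewrite mulr_ge0.
  exact: le_trans et tw4.
have T1 : `|p * a1 + (1 - p) * a0| <= C * w ^+ 3.
  apply: le_trans (ler_normD _ _) _;
    rewrite !normrM (gtr0_norm p_gt0) (ger0_norm q0).
  apply: le_trans (lerD (ler_wpM2l (ltW p_gt0) A1) (ler_wpM2l q0 A0)) _.
  by rewrite -mulrDl addrC subrK mul1r.
have p31 : 0 <= p ^+ 3 <= 1 by rewrite exprn_ge0 ?exprn_ile1// ltW.
have q31 : 0 <= (1 - p) ^+ 3 <= 1.
  by rewrite exprn_ge0 ?exprn_ile1// lerBlDr lerDl ltW.
have V01 : 0 <= V by rewrite ltW.
have T2 : `|2^-1 * V * w ^+ 2 * (p ^+ 3 * b1 + (1 - p) ^+ 3 * b0)| <= C * w ^+ 3.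
  have bb : `|p ^+ 3 * b1 + (1 - p) ^+ 3 * b0| <= 2 * (C * w).
    apply: le_trans (ler_normD _ _) _.
    rewrite (normrM (p ^+ 3)) (normrM ((1 - p) ^+ 3)) mulrDl mul1r.
    have /andP[? ?] := p31; have /andP[? ?] := q31.
    rewrite (ger0_norm (x := p ^+ 3))// (ger0_norm (x := (1 - p) ^+ 3))//.
    apply: lerD; first by apply: le_trans B1; rewrite ler_piMl.
    by apply: le_trans B0; rewrite ler_piMl.
  rewrite normrM ger0_norm; last by rewrite mulr_ge0// mulr_ge0.
  have -> : C * w ^+ 3 = w ^+ 2 * (C * w) by ring.
  have -> : 2^-1 * V * w ^+ 2 * `|p ^+ 3 * b1 + (1 - p) ^+ 3 * b0| =
    w ^+ 2 * (2^-1 * V * `|p ^+ 3 * b1 + (1 - p) ^+ 3 * b0|) by ring.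
  rewrite ler_wpM2l//; apply: le_trans (_ : 2^-1 * `|p ^+ 3 * b1 + (1 - p) ^+ 3 *
    b0| <= _).
    rewrite -mulrA ler_wpM2l// ler_piMl//; apply: le_trans V_le _; lra.
  by move: bb; lra.
have T3 : `|sc| <= C * w ^+ 3.
  apply: le_trans Sc _; rewrite ler_pM2l//; apply: le_trans e2w _; lra.
have d20 : 0 <= d ^+ 2 by exact: sqr_ge0.
have k20 : 0 <= k ^+ 2 by exact: sqr_ge0.
have Vd0 : 0 <= V * d ^+ 2 by exact: mulr_ge0.
have Vd1 : V * d ^+ 2 <= 1.
  by apply: mulr_ile1 => //; apply: le_trans V_le _; lra.
have hVd0 : 0 <= 2^-1 * V * d ^+ 2 by rewrite -mulrA mulr_ge0.
have T4 : `|2^-1 * V * d ^+ 2 * (k ^+ 2 * w ^+ 2) * sp| <= C * w ^+ 3.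
  have coef : 0 <= 2^-1 * V * d ^+ 2 * (k ^+ 2 * w ^+ 2) <= w ^+ 2.
    have kw0 : 0 <= k ^+ 2 * w ^+ 2 by exact: mulr_ge0.
    rewrite (mulr_ge0 hVd0 kw0) /=; apply: (@le_trans _ _ (k ^+ 2 * w ^+ 2)).
      by rewrite ler_piMl//; move: Vd1; lra.
    by rewrite ler_piMl.
  have /andP[c0 c1] := coef.
  rewrite normrM (ger0_norm c0).
  apply: le_trans (ler_pM c0 (normr_ge0 _) c1 Sp) _.
  have -> : w ^+ 2 * (C * e) = C * (w ^+ 2 * e) by ring.
  rewrite ler_pM2l//; apply: le_trans (_ : w ^+ 2 * w ^+ 2 <= _).
    by rewrite ler_wpM2l// (le_trans et tw).
  by rewrite wwE.
have T5 : `|(e - 2^-1 * t - 2^-1 * V * d ^+ 2 * w ^+ 2 * (1 - k ^+ 2)) * Pz| <=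
  C * w ^+ 3.
  have kt : 0 <= 1 - k ^+ 2 <= t.
    rewrite subr_ge0 k2 /=; have -> : 1 - k ^+ 2 = k ^+ 2 * t by move: kE; lra.
    by rewrite ler_piMl.
  have /andP[kt0 kt1] := kt.
  have c1 : 0 <= t * (1 - k ^+ 2) <= 16^-1 * w ^+ 4.
    rewrite mulr_ge0//= -wwE.
    have -> : 16^-1 * (w ^+ 2 * w ^+ 2) =
      (4^-1 * w ^+ 2) * (4^-1 * w ^+ 2) by field.
    by rewrite ler_pM// (le_trans kt1).
  have c2 : 0 <= V * d ^+ 2 * w ^+ 2 * (1 - k ^+ 2) <= w ^+ 4.
    have Vw0 : 0 <= V * d ^+ 2 * w ^+ 2 by exact: mulr_ge0.
    rewrite (mulr_ge0 Vw0 kt0) /= -wwE.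
    apply: ler_pM => //; first by rewrite ler_piMl.
    exact: le_trans kt1 tw.
  have coef : `|e - 2^-1 * t - 2^-1 * V * d ^+ 2 * w ^+ 2 * (1 - k ^+ 2)| <= w ^+ 3.
    have -> : 2^-1 * V * d ^+ 2 * w ^+ 2 * (1 - k ^+ 2) =
      2^-1 * (V * d ^+ 2 * w ^+ 2 * (1 - k ^+ 2)) by ring.
    have e20 : 0 <= e ^+ 2 by rewrite sqr_ge0.
    move: (V * d ^+ 2 * w ^+ 2 * _) c2 (t * (1 - _)) c1 eE => x2 c2 x1 c1 eE.
    by rewrite ler_norml; lra.
  rewrite normrM mulrC; apply: ler_pM => //.
have tri (u1 u2 u3 u4 u5 B : R) : `|u1| <= B -> `|u2| <= B -> `|u3| <= B ->
    `|u4| <= B -> `|u5| <= B -> `|u1 - u2 - u3 + u4 + u5| <= 5 * B.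
  by rewrite !ler_norml; lra.
by rewrite -[leRHS]mulrA; apply: tri.
Qed.

End lindeberg.

(** * Summing the Lindeberg steps *)

Section gauss_mean.
Context (R : realType) (p : R).
Hypotheses (p_gt0 : 0 < p) (p_lt1 : p < 1).

Let p01 : 0 <= p <= 1. Proof. by rewrite !ltW. Qed.

Lemma mean_dist n (F H : seq bool -> R) e :
  (forall u, size u = n -> `|F u - H u| <= e) -> `|mean p n F - mean p n H| <= e.
Proof.
move=> FH; rewrite ler_norml lerBlDr lerBrDr; apply/andP; split.
  rewrite -[X in X + _](mean_cst p n) -meanD; apply: ler_mean => // u un.
  by have := FH u un; rewrite ler_norml => /andP[]; lra.
rewrite -[X in X + _](mean_cst p n) -meanD; apply: ler_mean => // u un.
by have := FH u un; rewrite ler_norml => /andP[]; lra.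
Qed.

Lemma mean_telescope (G : nat -> seq bool -> R) e n :
  (forall k u, (k < n)%N -> size u = k ->
    `|p * G k.+1 (rcons u true) + (1 - p) * G k.+1 (rcons u false) - G k u| <= e) ->
  `|mean p n (G n) - G 0 [::]| <= e *+ n.
Proof.
elim: n => [|n IH] Gn; first by rewrite /= subrr normr0.
rewrite mulrS /=.
have -> : mean p n (fun u =>
  p * G n.+1 (rcons u true) + (1 - p) * G n.+1 (rcons u false))
    - G 0 [::] =
  (mean p n (fun u => p * G n.+1 (rcons u true) + (1 - p) * G n.+1 (rcons u false))
    - mean p n (G n)) + (mean p n (G n) - G 0 [::]) by ring.
apply: le_trans (ler_normD _ _) _; apply: lerD.
  by apply: mean_dist => u un; apply: Gn.
by apply: IH => k u kn; apply: Gn; lia.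
Qed.

Let V := p * (1 - p).
Let var := V * (1 - 3 * V).
Let var_gt0 : 0 < var. Proof. exact: run_variance_gt0. Qed.
Let c n := Num.sqrt (n%:R * var).

Let last_empty (u : seq bool) : R := (~~ last false u)%:R.

(* A martingale, by the choice of the last term. *)
Definition centered_runs (u : seq bool) : R :=
  (nb_runs u)%:R - p * (1 - p) *+ size u + p * (~~ last false u)%:R.

Let centered_runs_true u : centered_runs (rcons u true) =
  centered_runs u + (1 - p) * (last_empty u - p).
Proof.
rewrite /centered_runs nb_runs_rcons size_rcons last_rcons andbT natrD mulrS.
by rewrite /last_empty /=; ring.
Qed.

Let centered_runs_false u : centered_runs (rcons u false) =
  centered_runs u - p * (last_empty u - p).
Proof.
rewrite /centered_runs nb_runs_rcons0 size_rcons last_rcons mulrS.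
by rewrite /last_empty /=; ring.
Qed.

Lemma cvg_sqrt_run_variance : (c n)^-1 @[n --> \oo] --> (0 : R).
Proof.
apply/cvgrPdist_lt => e e0; near=> n.
have en : e ^- 2 / var < n%:R by near: n; exact: nbhs_infty_gtr.
have nv : e ^- 2 < n%:R * var by rewrite -ltr_pdivrMr.
have e20 : 0 < e ^- 2 by rewrite invr_gt0 exprn_gt0.
have c0 : 0 < c n by rewrite sqrtr_gt0 (lt_trans e20).
rewrite sub0r normrN gtr0_norm ?invr_gt0// invf_plt ?posrE//.
have -> : e^-1 = Num.sqrt (e ^- 2).
  by rewrite -exprVn sqrtr_sqr gtr0_norm// invr_gt0.
by rewrite ltr_sqrt// (lt_trans e20).
Unshelve. all: by end_near. Qed.

(** For fixed [eps] each letter costs order [(c n)^-1 ^+ 3], and n is [c n ^+ 2 / var], so the total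
    is of order [(c n)^-1]. *)
Lemma mean_gauss_bound a eps : 0 < eps -> exists2 K : R, 0 <= K &
  forall n, (0 < n)%N -> (c n)^-1 <= Num.min eps 1 ->
  `|mean p n (fun u => gauss_cdf ((a - centered_runs u / c n) / eps)) -
    gauss_cdf ((a - p / c n) / Num.sqrt (1 + eps ^+ 2))| <= K * (c n)^-1.
Proof.
move=> eps0; have [C C0 [psiC step]] := lindeberg_step p_gt0 p_lt1.
exists (5 * C / (var * eps ^+ 3) + 2 * C / eps ^+ 2).
  have e2 := exprn_gt0 2 eps0; have e3 := exprn_gt0 3 eps0.
  by apply/ltW/addr_gt0; apply: divr_gt0 => //; apply: mulr_gt0 => //;
    exact: mulr_gt0.
move=> n n0; rewrite le_min => /andP[ceps c1].
have nn0 : 0 < n%:R :> R by rewrite ltr0n.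
have cc : c n ^+ 2 = n%:R * var by rewrite sqr_sqrtr// mulr_ge0// ltW.
have c0 : 0 < c n by rewrite sqrtr_gt0 mulr_gt0.
(* The square is [eps ^+ 2] plus the fraction of the variance still to come: the scale is [eps] at
   time n and [Num.sqrt (1 + eps ^+ 2)] at time 0. *)
pose s k := Num.sqrt (eps ^+ 2 + (n - k)%:R / n%:R).
have s2 k : s k ^+ 2 = eps ^+ 2 + (n - k)%:R / n%:R.
  by rewrite sqr_sqrtr// addr_ge0 ?sqr_ge0 ?divr_ge0.
have s_eps k : eps <= s k.
  rewrite -[leLHS]gtr0_norm// -sqrtr_sqr ler_wsqrtr// lerDl divr_ge0//.
have s0 k : 0 < s k := lt_le_trans eps0 (s_eps k).
pose w k := (c n * s k)^-1.
have w0 k : 0 < w k by rewrite invr_gt0 mulr_gt0.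
have w_eps k : w k <= (c n * eps)^-1.
  by rewrite lef_pV2 ?posrE ?mulr_gt0// ler_pM2l.
have w1 k : w k <= 1.
  apply: le_trans (w_eps k) _; rewrite invfM ler_pdivrMr// mul1r.
  exact: ceps.
pose G k u := smoothed p ((a - centered_runs u / c n) / s k) (w k) (last_empty u).
have b1 u : `|last_empty u - p| <= 1.
  have := p_gt0; have := p_lt1.
  by rewrite /last_empty; case: (last _ _) => /=; rewrite ler_norml; lra.
have Gstep k u : (k < n)%N -> size u = k ->
    `|p * G k.+1 (rcons u true) + (1 - p) * G k.+1 (rcons u false) - G k u|
    <= 5 * C * (c n * eps)^-1 ^+ 3.
  move=> kn _; rewrite /G centered_runs_true centered_runs_false.
  have -> : last_empty (rcons u true) = 0 by rewrite /last_empty last_rcons.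
  have -> : last_empty (rcons u false) = 1 by rewrite /last_empty last_rcons.
  have zE : (a - centered_runs u / c n) / s k =
      (s k.+1 / s k) * ((a - centered_runs u / c n) / s k.+1).
    by field; rewrite !gt_eqF.
  have wE : w k = s k.+1 / s k * w k.+1.
    by rewrite /w !invfM; field; rewrite !gt_eqF.
  rewrite zE wE.
  have -> : (a - (centered_runs u + (1 - p) * (last_empty u - p)) / c n) / s k.+1 =
      (a - centered_runs u / c n) / s k.+1 - (1 - p) * (last_empty u - p) * w k.+1.
    by rewrite /w invfM; field; rewrite !gt_eqF.
  have -> : (a - (centered_runs u - p * (last_empty u - p)) / c n) / s k.+1 =
      (a - centered_runs u / c n) / s k.+1 + p * (last_empty u - p) * w k.+1.
    by rewrite /w invfM; field; rewrite !gt_eqF.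
  apply: le_trans (step _ (w k.+1) _ (s k.+1 / s k) _ (b1 u) _ _) _.
  - by rewrite w0 w1.
  - by rewrite divr_gt0.
  - have s2k : s k ^+ 2 = s k.+1 ^+ 2 + n%:R^-1.
      rewrite !s2; have -> : (n - k)%:R = (n - k.+1)%:R + 1 :> R.
        by rewrite natr1; congr _%:R; lia.
      by rewrite mulrDl mul1r addrA.
    rewrite expr_div_n s2k /w exprVn exprMn cc -/V -/var.
    have S0 : 0 < s k.+1 ^+ 2 by rewrite exprn_gt0.
    move: (s k.+1 ^+ 2) S0 => S S0; field.
    by rewrite !gt_eqF//= addr_gt0// mulr_gt0.
  - by rewrite ler_pM2l ?mulr_gt0// lerXn2r ?nnegrE ?invr_ge0 ?mulr_ge0// ltW.
have T := mean_telescope Gstep.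
have near_cdf z k b : `|b - p| <= 1 -> `|smoothed p z (w k) b - gauss_cdf z| <=
  C * (c n)^-1 / eps ^+ 2.
  move=> b1'; rewrite /smoothed addrC addKr normrN.
  have V0 : 0 < V by rewrite mulr_gt0// subr_gt0.
  have V1 : V <= 1 by rewrite mulr_ile1 ?subr_ge0 ?(ltW p_lt1) ?(ltW p_gt0)//
    lerBlDr lerDl ltW.
  have b2 : 0 <= (b - p) ^+ 2 <= 1.
    by rewrite sqr_ge0 -[X in X <= _]real_normK ?num_real// exprn_ile1.
  have /andP[b20 b21] := b2.
  have w2 : 0 <= w k ^+ 2 <= (c n)^-1 / eps ^+ 2.
    rewrite sqr_ge0 /=; apply: (@le_trans _ _ ((c n * eps)^-1 ^+ 2)).
      by rewrite lerXn2r ?nnegrE ?invr_ge0 ?mulr_ge0// ltW.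
    rewrite invfM exprMn !exprVn ler_wpM2r ?invr_ge0 ?sqr_ge0//.
    by rewrite -exprVn expr2 ler_piMl// invr_ge0 ltW.
  have /andP[w20 w21] := w2.
  have V2 : 0 <= 2^-1 * V <= 1 by have := ltW V0; lra.
  have /andP[V20 V21] := V2.
  rewrite normrM mulrC -[leRHS]mulrA; apply: ler_pM => //.
  rewrite ger0_norm; last exact: mulr_ge0 (mulr_ge0 V20 b20) w20.
  by apply: le_trans w21; rewrite ler_piMl// mulr_ile1.
have D1 : `|mean p n (fun u =>
  gauss_cdf ((a - centered_runs u / c n) / eps)) - mean p n (G n)|
    <= C * (c n)^-1 / eps ^+ 2.
  apply: mean_dist => u _; rewrite distrC /G.
  have -> : s n = eps by rewrite /s subnn mul0r addr0 sqrtr_sqr gtr0_norm.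
  exact: near_cdf.
have D2 : `|G 0%N [::] - gauss_cdf ((a - p / c n) / Num.sqrt (1 + eps ^+ 2))|
    <= C * (c n)^-1 / eps ^+ 2.
  (* The empty word counts as ending with an empty box, so the martingale starts at [p]; hence the
     shift [p / c n]. *)
  rewrite /G /centered_runs /= mulr1 mulr0n subr0 add0r.
  have -> : s 0%N = Num.sqrt (1 + eps ^+ 2).
    by rewrite /s subn0 divff ?gt_eqF// addrC.
  exact: near_cdf.
have TE : 5 * C * (c n * eps)^-1 ^+ 3 *+ n = 5 * C / (var * eps ^+ 3) * (c n)^-1.
  have nE : n%:R = c n ^+ 2 / var by rewrite cc mulfK// gt_eqF.
  by rewrite -mulr_natr nE; field; rewrite !gt_eqF.
rewrite TE in T.
have -> : (5 * C / (var * eps ^+ 3) + 2 * C / eps ^+ 2) * (c n)^-1 =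
    C * (c n)^-1 / eps ^+ 2 + (5 * C / (var * eps ^+ 3) * (c n)^-1
    + C * (c n)^-1 / eps ^+ 2) by ring.
apply: le_trans (ler_distD (mean p n (G n)) _ _) (lerD D1 _).
exact: le_trans (ler_distD (G 0%N [::]) _ _) (lerD T D2).
Qed.

End gauss_mean.

Section gauss_cdf_facts.
Context {R : realType}.

Lemma normal_prob_itvNy (x : R) :
  normal_prob (0 : R) 1 `]-oo, x]%classic = (gauss_cdf x)%:E.
Proof. by rewrite /gauss_cdf fineK// fin_num_measure. Qed.

Lemma gauss_cdf_itv (x : R) : 0 <= gauss_cdf x <= 1.
Proof. by rewrite -!lee_fin -normal_prob_itvNy measure_ge0 probability_le1. Qed.

Lemma gauss_cdf_lipschitz : exists2 D : R, 0 < D &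
  forall x y : R, `|gauss_cdf x - gauss_cdf y| <= D * `|x - y|.
Proof.
have D0 : 0 < normal_peak (1 : R) by rewrite normal_peak_gt0 ?oner_neq0.
exists (normal_peak 1) => // x y.
pose f t := gauss_cdf (y + 1 * t) - gauss_cdf y.
have : `|f (x - y)| <= normal_peak 1 * `|x - y| ^+ 1.
  apply: (@mvt_pow_bound R f (fun t => 1 * gauss_pdf (y + 1 * t))) => [t||t _].
  - have := is_derive_affine y 1 t is_derive_gauss_cdf => dt.
    by rewrite /f; apply: is_derive_eq; rewrite subr0.
  - by rewrite /f mulr0 addr0 subrr.
  - rewrite mul1r expr0 mulr1 ger0_norm ?gauss_pdf_ge0//.
    by rewrite /gauss_pdf normal_pdf_ub ?oner_neq0.
by rewrite /f mul1r expr1 (_ : y + (x - y) = x)//; ring.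
Qed.

(** The identity as a random variable under the normal law, which gives access to the limits of
    [cdf] at infinity. *)
Let idR : measurableTypeR R -> R := idfun.

#[local] HB.instance Definition _ :=
  @isMeasurableFun.Build _ _ _ _ idR (@measurable_id _ _ setT).

Lemma gauss_cdf_tails (e : R) : 0 < e -> exists2 K : R, 0 < K &
  (forall x, K <= x -> 1 - e <= gauss_cdf x) /\ (forall x, x <=
    - K -> gauss_cdf x <= e).
Proof.
move=> e0; pose F := cdf (idR : {RV (normal_prob (0 : R) 1) >-> R}).
have FE r : F r = (gauss_cdf r)%:E by rewrite -normal_prob_itvNy.
have Fy : gauss_cdf r @[r --> +oo] --> (1 : R).
  have := cvg_cdfy1 (idR : {RV (normal_prob (0 : R) 1) >-> R}).
  by rewrite -/F (funext FE) => /fine_cvgP[_].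
have FNy : gauss_cdf r @[r --> -oo] --> (0 : R).
  have := cvg_cdfNy0 (idR : {RV (normal_prob (0 : R) 1) >-> R}).
  by rewrite -/F (funext FE) => /fine_cvgP[_].
have /cvgrPdist_le/(_ e e0)[K1 [_ K1P]] := Fy.
have /cvgrPdist_le/(_ e e0)[K2 [_ K2P]] := FNy.
exists (1 + `|K1| + `|K2|); first by rewrite ltr_wpDr// ltr_wpDr.
split=> x xK.
  have /K1P /= : K1 < x.
    by have := ler_norm K1; have := normr_ge0 K2; lra.
  by rewrite ler_norml; lra.
have /K2P /= : x < K2.
  by have := ler_norm (- K2); rewrite normrN; have := normr_ge0 K1; lra.
by rewrite sub0r normrN ler_norml; lra.
Qed.

End gauss_cdf_facts.

(** * Removing the smoothing *)

Section normal_approximation.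
Context (R : realType) (p : R).
Hypotheses (p_gt0 : 0 < p) (p_lt1 : p < 1).

Let V := p * (1 - p).
Let c n := Num.sqrt (n%:R * (V * (1 - 3 * V))).

Lemma cvg_mean_runs (x : R) :
  mean p n (fun u => (((nb_runs u)%:R - n%:R * V) / c n <= x)%R%:R) @[n --> \oo]
  --> gauss_cdf x.
Proof.
have p01 : 0 <= p <= 1 by rewrite !ltW.
have var0 : 0 < V * (1 - 3 * V) by exact: run_variance_gt0.
apply/cvgrPdist_le => e e_gt0.
have e40 : 0 < e / 4 by rewrite divr_gt0.
have [K K0 [tail1 tail0]] := gauss_cdf_tails e40.
have [D D0 lip] := @gauss_cdf_lipschitz R.
have xK0 : 0 < D * (`|x| + 2 * K) by rewrite mulr_gt0// ltr_wpDl// mulr_gt0.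
(* Small enough that both the shift of the threshold and the extra variance [eps ^+ 2] move the
   limit by at most [e / 4]. *)
pose eps := Num.min 1 (e / 4 / (D * (`|x| + 2 * K))).
have eps0 : 0 < eps by rewrite lt_min ltr01 divr_gt0.
have eps1 : eps <= 1 by rewrite ge_min lexx.
have epse : D * ((`|x| + 2 * K) * eps) <= e / 4.
  by rewrite mulrA mulrC -ler_pdivlMr// ge_min lexx orbT.
pose s := Num.sqrt (1 + eps ^+ 2).
have s2 : s ^+ 2 = 1 + eps ^+ 2 by rewrite sqr_sqrtr// addr_ge0// sqr_ge0.
have s1 : 1 <= s by rewrite -[leLHS]sqrtr1 ler_wsqrtr// lerDl sqr_ge0.
have s0 : 0 < s := lt_le_trans ltr01 s1.
have close b : `|b| <= 2 * K -> `|gauss_cdf ((x + b * eps) / s) - gauss_cdf x| <=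
  e / 4.
  move=> bK; apply: le_trans (lip _ _) _; apply: le_trans epse.
  rewrite ler_pM2l//.
  have -> : (x + b * eps) / s - x = (b * eps - x * (s - 1)) / s by field;
    rewrite gt_eqF.
  rewrite normf_div (gtr0_norm s0) ler_pdivrMr//.
  apply: (@le_trans _ _ ((`|x| + 2 * K) * eps)); last first.
    by rewrite ler_peMr// mulr_ge0 ?ltW// ltr_wpDl// mulr_gt0.
  apply: le_trans (ler_normB _ _) _; rewrite !normrM mulrDl addrC; apply: lerD.
    rewrite ler_wpM2l// ger0_norm ?subr_ge0//.
    have : (s - 1) * (s + 1) <= eps * 1.
      have -> : (s - 1) * (s + 1) = s ^+ 2 - 1 by ring.
      have -> : s ^+ 2 - 1 = eps * eps by rewrite s2; ring.
      by rewrite ler_pM2l.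
    by rewrite mulr1; apply: le_trans; rewrite ler_peMr ?subr_ge0//; lra.
  by rewrite (gtr0_norm eps0) ler_wpM2r// ltW.
(* The indicator is squeezed between two smoothed ones. The upper shift is [2 * K * eps] because one
   [K * eps] absorbs the bounded term, at most [p / c n], by which the martingale exceeds the
   centred number of runs; this term is nonnegative, so [- K * eps] suffices below. *)
have [K1 K10 B1] := mean_gauss_bound p_gt0 p_lt1 (x + 2 * K * eps) eps0.
have [K2 K20 B2] := mean_gauss_bound p_gt0 p_lt1 (x + - K * eps) eps0.
have shift a n : (0 < n)%N -> `|gauss_cdf ((a - p / c n) / s) - gauss_cdf (a /
  s)| <= D * (c n)^-1.
  move=> n0; have c0 : 0 < c n by rewrite sqrtr_gt0 mulr_gt0// ltr0n.
  apply: le_trans (lip _ _) _; rewrite ler_pM2l// -mulrBl addrAC subrr sub0r.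
  rewrite mulNr normrN !normrM (gtr0_norm p_gt0) !gtr0_norm ?invr_gt0//.
  rewrite mulrAC ler_piMl ?invr_ge0 ?(ltW c0)//.
  by rewrite mulr_ile1 ?invr_ge0 ?(ltW p_gt0) ?(ltW s0) ?(ltW p_lt1) ?invf_le1.
have Ke0 : 0 < K * eps by rewrite mulr_gt0.
have KKD : 0 < K1 + K2 + D by rewrite ltr_wpDl// addr_ge0.
have m0 : 0 < Num.min (e / 4 / (K1 + K2 + D)) (Num.min eps (K * eps / p)).
  rewrite lt_min (divr_gt0 e40 KKD) /= lt_min eps0 /=.
  exact: divr_gt0.
have /cvgrPdist_lt/(_ _ m0) c_small := cvg_sqrt_run_variance p_gt0 p_lt1.
near=> n.
have n0 : (0 < n)%N by near: n; exact: nbhs_infty_gt.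
have c0 : 0 < c n by rewrite sqrtr_gt0 mulr_gt0// ltr0n.
have : (c n)^-1 < Num.min (e / 4 / (K1 + K2 + D)) (Num.min eps (K * eps / p)).
  have : `|0 - (c n)^-1| < Num.min (e / 4 / (K1 + K2 + D)) (Num.min eps (K * eps
    / p)).
    by near: n; exact: c_small.
  by rewrite sub0r normrN gtr0_norm ?invr_gt0.
rewrite lt_min => /andP[ce]; rewrite lt_min => /andP[ceps cK].
have c_min : (c n)^-1 <= Num.min eps 1.
  by rewrite le_min (ltW ceps) (le_trans (ltW ceps)).
have pc : p / c n <= K * eps.
  by rewrite mulrC -ler_pdivlMr// ltW.
have cKKD : (K1 + K2 + D) * (c n)^-1 <= e / 4.
  by rewrite mulrC -ler_pdivlMr// ltW.
have ci0 : 0 <= (c n)^-1 by rewrite invr_ge0 ltW.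
have k10 : 0 <= K1 * (c n)^-1 by rewrite mulr_ge0.
have k20 : 0 <= K2 * (c n)^-1 by rewrite mulr_ge0.
have kd0 : 0 <= D * (c n)^-1 by rewrite mulr_ge0// ltW.
rewrite !mulrDl in cKKD.
have centered u : size u = n ->
    centered_runs p u / c n =
      ((nb_runs u)%:R - n%:R * V) / c n + p * (~~ last false u)%:R / c n.
  by move=> un; rewrite /centered_runs un -mulrDl -[_ *+ n]mulr_natl.
have pb u : 0 <= p * (~~ last false u)%:R / c n <= p / c n.
  case: (last _ _) => /=;
    first by rewrite mulr0 mul0r lexx divr_ge0 ?(ltW p_gt0) ?(ltW c0).
  by rewrite mulr1 lexx andbT divr_ge0 ?(ltW p_gt0) ?(ltW c0).
set M := mean p n _.
have up : M <= mean p n (fun u =>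
  gauss_cdf ((x + 2 * K * eps - centered_runs p u / c n) / eps)) + e / 4.
  rewrite -[X in _ <= _ + X](mean_cst p n) -meanD; apply: ler_mean => // u un.
  set g := gauss_cdf _; have /andP[g0 g1] : 0 <= g <= 1 by exact: gauss_cdf_itv.
  case: (boolP (_ <= x)%R) => Yx /=; last by rewrite addr_ge0// ltW.
  rewrite -lerBlDr; apply: tail1; rewrite ler_pdivlMr// centered//.
  by have /andP[_] := pb u; lra.
have low : mean p n (fun u =>
  gauss_cdf ((x + - K * eps - centered_runs p u / c n) / eps)) <= M + e / 4.
  rewrite -[X in _ <= _ + X](mean_cst p n) -meanD; apply: ler_mean => // u un.
  set g := gauss_cdf _; have /andP[g0 g1] : 0 <= g <= 1 by exact: gauss_cdf_itv.
  case: (boolP (_ <= x)%R) => Yx /=; first by rewrite (le_trans g1)// lerDl ltW.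
  rewrite add0r; apply: tail0; rewrite ler_pdivrMr// centered//.
  by move: Yx; rewrite -ltNge; have /andP[+ _] := pb u; lra.
have b1 := B1 n n0 c_min; have b2 := B2 n n0 c_min.
have s1' := shift (x + 2 * K * eps) n n0; have s2' := shift (x + - K * eps) n n0.
have cl1 : `|gauss_cdf ((x + 2 * K * eps) / s) - gauss_cdf x| <= e / 4.
  by apply: close; rewrite ger0_norm// mulr_ge0// ltW.
have cl2 : `|gauss_cdf ((x + - K * eps) / s) - gauss_cdf x| <= e / 4.
  by apply: close; rewrite normrN gtr0_norm//; lra.
move: up low b1 b2 s1' s2' cl1 cl2; rewrite -/(c n) -/s.
move: (mean p n (fun u => gauss_cdf _)) (mean p n (fun u => gauss_cdf _)) M =>
  A1 A2 M.
move: (gauss_cdf _) (gauss_cdf _) (gauss_cdf _) (gauss_cdf _) (gauss_cdf _) =>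
  g1 g2 g3 g4 g5.
rewrite !ler_norml.
lra.
Unshelve. all: by end_near. Qed.

End normal_approximation.

Theorem theorem1 (R : realType) (d : measure_display) (T : measurableType d)
    (P : probability T R) (p : R) (xi : nat -> {RV P >-> R})
    (p_gt0 : 0 < p) (p_lt1 : p < 1)
    (xi_iid : iid xi)
    (xi_up : P [set w | xi 0%N w = 1] = p%:E)
    (xi_down : P [set w | xi 0%N w = -1] = (1 - p)%:E) :
  (forall i : nat, (1 <= i)%N ->
     let q := P [set w | max_until_return (fun k => xi k w) = i%:R%:E] in
     {ae P, forall w,
        (rho i n (fun k => xi k w))%:R / n%:R @[n --> \oo] --> fine q} /\
     (0 < q)%E) /\
  cvg_in_distribution P
    (fun n w =>
       ((rho 1 n (fun k => xi k w))%:R - n%:R * p * (1 - p)) /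
       Num.sqrt (n%:R * p * (1 - p) * (1 - 3 * p * (1 - p))))
    (normal_prob 0 1).
Proof.
split.
  move=> [//|m] _; rewrite /= (prob_max_until_return m p_gt0 p_lt1)//=.
  by split; [exact: ae_cvg_rho|rewrite lte_fin soliton_density_gt0].
(* For solitons of length at least 1 the carrier has capacity 0 and its overflow is the word itself;
   as a function of the word the variable is measurable, and its law is a [mean]. *)
pose Y n (u : seq bool) : R := ((nb_runs u)%:R - n%:R * (p * (1 - p))) /
  Num.sqrt (n%:R * (p * (1 - p) * (1 - 3 * (p * (1 - p))))).
set Z := fun _ => _; have ZE n w : Z n w = Y n (word_of_steps (fun k => xi k w) n).
  by rewrite /Z /Y rhoE /nb_overflow_runs overflow0 !mulrA.
split=> [n _ B mB|x _].
  rewrite setTI (_ : _ @^-1` B = [set w | `[< B (Y n (word_of_steps (fun k =>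
    xi k w) n)) >]]).
    exact: (measurable_word xi n (fun u => `[< B (Y n u) >])).
  by apply/seteqP; split => w /=; rewrite ZE => /asboolP.
rewrite -[X in _ --> X]/(normal_prob (0 : R) 1 `]-oo, x]%classic) normal_prob_itvNy.
under eq_fun => n.
  under eq_set do rewrite ZE.
  rewrite (prob_word xi_iid xi_up n (fun u => Y n u <= x)%R).
  over.
by apply: cvg_EFin; [exact: nearW|exact: cvg_mean_runs].
Qed.
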